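(* In the Jacobi setting of the context, with $a_j>-1$ and $b_j>a_j$ for $1\le j\le q$, let $\boldsymbol n\in\mathbb N_0^p$, $\boldsymbol m\in\mathbb N_0^q$ with $|\boldsymbol m|=|\boldsymbol n|+1$ and $|m_i-m_j|\le1$ for all $i,j$. Assume that the nodes $-b_j-\ell$ ($m_j\ge1$, $0\le\ell\le m_j-1$) are pairwise distinct, that $b_h\ne b_j$ whenever $h\ne j$ and $m_j\ge1$, and that $a_\rho-b_J\notin\{0,1,\dots,m_J-1\}$ for all $\rho$ and all $J$ with $m_J\ge1$. Let $\mathcal B_{\boldsymbol n,\boldsymbol m}$ be the normalized mixed form defined in the context. Then, for $0<x<1$, $$\mathcal B_{\boldsymbol n,\boldsymbol m}(x)=-\mathscr R_{\boldsymbol\alpha,\boldsymbol n}\bigl[w_0(\cdot;\boldsymbol a,\boldsymbol b+\boldsymbol m)\bigr](x)=-\bigl(\mathscr R_{\alpha_1,n_1}\circ\cdots\circ\mathscr R_{\alpha_p,n_p}\bigr)\bigl[w_0(\cdot;\boldsymbol a,\boldsymbol b+\boldsymbol m)\bigr](x).$$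
   Context: Conventions. $(c)_k=c(c+1)\cdots(c+k-1)$. For vectors, $\Gamma(\boldsymbol c)=\prod\Gamma(c_i)$, $(\boldsymbol c)_{\boldsymbol\nu}=\prod(c_i)_{\nu_i}$, $|\boldsymbol\nu|=\sum\nu_i$; $\mathbf 1_d=(1,\dots,1)$; $\boldsymbol e_j$ coordinate vector; $\mathbb P_N$: complex polynomials of degree at most $N$ ($\{0\}$ if $N<0$). $\mathcal M[f](s)=\int_0^\infty x^{s-1}f(x)dx$. Rodrigues operators: for $\gamma\in\mathbb R$, $n\in\mathbb N_0$, $\mathscr R_{\gamma,n}[f](x)=x^{-\gamma}\frac{d^n}{dx^n}\bigl(x^{\gamma+n}f(x)\bigr)$. These operators commute, and $\mathscr R_{\boldsymbol\gamma,\boldsymbol n}=\mathscr R_{\gamma_1,n_1}\circ\cdots\circ\mathscr R_{\gamma_p,n_p}$. Jacobi setting. $p,q\ge1$; $\boldsymbol a,\boldsymbol b\in\mathbb R^q$ with $-1<a_j<b_j$; $\boldsymbol\alpha\in\mathbb R^p$ with $\alpha_i+a_\rho>-1$ for all $i,\rho$. $\mathcal B_{a,b}(x)=x^a(1-x)^{b-a-1}/\Gamma(b-a)$ on $(0,1)$, $0$ elsewhere; $(f*g)(x)=\int_0^\infty f(t)g(x/t)dt/t$; $w_0(x;\boldsymbol a,\boldsymbol b)=\mathcal B_{a_1,b_1}*\cdots*\mathcal B_{a_q,b_q}(x)$, so $\mathcal M[w_0](s)=\Gamma(s\mathbf 1_q+\boldsymbol a)/\Gamma(s\mathbf 1_q+\boldsymbol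 b)$; $w_j(x;\boldsymbol a,\boldsymbol b)=w_0(x;\boldsymbol a,\boldsymbol b+\boldsymbol e_j)$. Normalized mixed form: $\mathcal B_{\boldsymbol n,\boldsymbol m}=\sum_{j=1}^qB^{(j)}w_j(\cdot;\boldsymbol a,\boldsymbol b)$ with $B^{(j)}\in\mathbb P_{m_j-1}$, satisfying $\int_0^1\mathcal B_{\boldsymbol n,\boldsymbol m}(x)x^{\alpha_i+r}dx=0$ for $1\le i\le p$, $0\le r\le n_i-1$, and normalized by $$\mathcal M[\mathcal B_{\boldsymbol n,\boldsymbol m}](s)=-\frac{\Gamma(s\mathbf 1_q+\boldsymbol a)}{\Gamma(s\mathbf 1_q+\boldsymbol b+\boldsymbol m)}(\boldsymbol\alpha+(1-s)\mathbf 1_p)_{\boldsymbol n}.$$ (Under the stated hypotheses such a form exists.) *)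

(* Defs.v *)
From HB Require Import structures.
From mathcomp Require Export all_boot all_order all_algebra.
From mathcomp Require Export complex.
From mathcomp Require Export all_classical all_reals all_analysis.
Export Order.TTheory GRing.Theory Num.Theory.
Export numFieldNormedType.Exports.

Set Implicit Arguments.
Unset Strict Implicit.
Unset Printing Implicit Defensive.

Local Open Scope classical_set_scope.
Local Open Scope complex_scope.
Local Open Scope ring_scope.

(* Euler's integral: the usual Gamma function for x > 0 only. Below it is
   applied to b_j - a_j > 0. *)
Definition Gamma (R : realType) (x : R) : R :=
  \int[lebesgue_measure]_(t in `]0, +oo[) (t `^ (x - 1) * expR (- t)).

Definition cintegral (R : realType) (D : set R) (f : R -> R[i]) : R[i] :=
  (\int[lebesgue_measure]_(x in D) complex.Re (f x))
  +i* (\int[lebesgue_measure]_(x in D) complex.Im (f x)).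

(* Principal power x^z = exp (z * ln x); meaningful for x > 0. *)
Definition cpow (R : realType) (x : R) (z : R[i]) : R[i] :=
  (expR (complex.Re z * ln x))%:C
  * (cos (complex.Im z * ln x) +i* sin (complex.Im z * ln x)).

Definition mellin (R : realType) (f : R -> R[i]) (s : R[i]) : R[i] :=
  cintegral `]0, +oo[ (fun x => cpow x (s - 1) * f x).

(* Euler's integral again: the usual Gamma function for Re z > 0 only. *)
Definition cGamma (R : realType) (z : R[i]) : R[i] :=
  mellin (fun t => (expR (- t))%:C) z.

Definition pochhammer (K : nzRingType) (c : K) (k : nat) : K :=
  \prod_(l < k) (c + l%:R).

Definition beta_kernel (R : realType) (a b x : R) : R :=
  if (0 < x) && (x < 1)
  then x `^ a * (1 - x) `^ (b - a - 1) / Gamma (b - a) else 0.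

Definition mconv (R : realType) (f g : R -> R) (x : R) : R :=
  \int[lebesgue_measure]_(t in `]0, +oo[) (f t * g (x / t) / t).

(* Multiplicative convolution has no unit among functions, so the iterated
   convolution is over a nonempty sequence; the value 0 for [::] is a dummy. *)
Definition mconv_seq (R : realType) (fs : seq (R -> R)) : R -> R :=
  if fs is f :: fs' then foldl (@mconv R) f fs' else fun=> 0.

Definition w0 (R : realType) (q : nat) (a b : 'I_q -> R) : R -> R :=
  mconv_seq [seq beta_kernel (a j) (b j) | j <- enum 'I_q].

Definition w (R : realType) (q : nat) (a b : 'I_q -> R) (j : 'I_q) : R -> R :=
  w0 a (fun k => b k + (k == j)%:R).

Definition rodrigues (R : realType) (gamma : R) (n : nat) (f : R -> R) : R -> R :=
  fun x => x `^ (- gamma) * derive1n n (fun y => y `^ (gamma + n%:R) * f y) x.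

(* foldr applies the operator of index p - 1 first: the composition is
   R_(gamma_1, n_1) \o ... \o R_(gamma_p, n_p). *)
Definition rodrigues_vec (R : realType) (p : nat) (gamma : 'I_p -> R)
    (n : 'I_p -> nat) (f : R -> R) : R -> R :=
  foldr (fun i g => rodrigues (gamma i) (n i) g) f (enum 'I_p).

Definition linear_form (R : realType) (q : nat) (a b : 'I_q -> R)
    (B : 'I_q -> {poly R[i]}) (x : R) : R[i] :=
  \sum_(j < q) (B j).[x%:C] * (w a b j x)%:C.

(* The coefficients B^(j) determine a normalized mixed form. The condition
   size (B j) <= m j says deg B^(j) <= m_j - 1, and B^(j) = 0 if m_j = 0.
   The Mellin transform is prescribed where its integral converges, namely for
   Re s > - a_j for all j; there all the Gamma arguments have positive real
   part, since a_j < b_j. *)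
Record normalized_mixed_form (R : realType) (p q : nat) (a b : 'I_q -> R)
    (alpha : 'I_p -> R) (n : 'I_p -> nat) (m : 'I_q -> nat)
    (B : 'I_q -> {poly R[i]}) : Prop := NormalizedMixedForm {
  mixed_form_size : forall j, (size (B j) <= m j)%N;
  mixed_form_orthogonal : forall (i : 'I_p) (r : nat), (r < n i)%N ->
    cintegral `]0, 1[
      (fun x => linear_form a b B x * (x `^ (alpha i + r%:R))%:C) = 0;
  mixed_form_mellin : forall s : R[i],
    (forall j, 0 < complex.Re s + a j) ->
    mellin (linear_form a b B) s =
    - ((\prod_(j < q) cGamma (s + (a j)%:C))
       / (\prod_(j < q) cGamma (s + (b j + (m j)%:R)%:C))
       * \prod_(i < p) pochhammer ((alpha i)%:C + (1 - s)) (n i))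
}.

(* Main.v *)
(* Mellin transforms of functions on (0, 1) are tested only at the positive
   integers, where they are power moments.  Convolving with x^b on (0, 1) turns
   the kernel of parameter b into the one of parameter b + 1, so w0 with b_j
   raised by one is x^(b_j) times the integral over (x, 1) of u^(-b_j - 1) times
   w0.  Hence the Euler operator x d/dx maps w0(b + e_j) to
   b_j w0(b + e_j) - w0(b), and the Rodrigues operator, a polynomial of degree
   |n| = |m| - 1 in the Euler operator, sends w0(b + m) to a linear combination
   of continuous functions w0(b + nu) with |nu| >= 1, multiplying the moments by
   the Pochhammer factors.  Both sides of the identity then have the same
   moments and are continuous on (0, 1), which forces them to coincide. *)
Require Import Defs.
From mathcomp Require Import measurable_realfun ring lra.

Set Implicit Arguments.
Unset Strict Implicit.
Unset Printing Implicit Defensive.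

Local Open Scope classical_set_scope.
Local Open Scope complex_scope.
Local Open Scope ring_scope.

(** * Haar measure on the positive half-line *)

Section haar.
Local Open Scope ereal_scope.
Context {R : realType}.
Local Notation mu := (@lebesgue_measure R).
Implicit Types (f g h : R -> \bar R).

(** Whether an iterated convolution converges at a given point is not known in advance, and a
    divergent real-valued integral has the value 0 by convention. Commutativity and associativity
    are therefore proved for functions with values in [0, +oo], where Tonelli's theorem asks only
    for measurability; the return to real values costs a null set, controlled by the finiteness of a
    Mellin transform. All changes of variables reduce to the invariance of dt/t under scaling and
    inversion and of dt under translation. The Mellin transform of a beta kernel is not computed
    from a Beta integral: it comes from a convolution identity with x^b e^(-x). Continuity of a
    weight is produced by one convolution with a power kernel, and each derivative undoes one such
    convolution; the excess |m| - |n| = 1 is what is left at the end. Since the functions may be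
    unbounded near 0 and 1, uniqueness for moments relies on absolute integrability and on
    continuity at a single interior point. *)

Lemma ge0_integral_scale f (c : R) : (0 < c)%R ->
  measurable_fun [set: R] f -> (forall x, 0 <= f x) ->
  \int[mu]_x f x = c%:E * \int[mu]_x f (c * x)%R.
Proof.
move=> c0 mf f0.
pose phi : measurableTypeR R -> measurableTypeR R := *%R c.
have mphi : measurable_fun setT phi by exact: mulrl_measurable.
pose nu := measure_function_pushforward__canonical__measure_function_Measure mu mphi.
have : \int[mu]_x f x = \int[mscale (NngNum (ltW c0)) nu]_x f x.
  apply: eq_measure_integral => A mA _.
  (* The rescaled image measure gives each half-open interval its length, which characterizes
     Lebesgue measure. *)
  apply: lebesgue_measure_unique => //= _ [[a b]] _ <-.
  rewrite /mscale/= /pushforward/=.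
  have -> : phi @^-1` `]a, b]%classic = `](a / c)%R, (b / c)%R]%classic.
    by apply/seteqP; split => x; rewrite /= !in_itv/= /phi ltr_pdivrMr// ler_pdivlMr// mulrC.
  rewrite !lebesgue_measure_itv/= !lte_fin ltr_pM2r ?invr_gt0//.
  case: ifPn => ab; last by rewrite mule0.
  by rewrite -!EFinB -EFinM -mulrBl mulrCA divff ?mulr1// gt_eqF.
move=> ->; rewrite ge0_integral_mscale//=.
by rewrite ge0_integral_pushforward.
Qed.

Lemma ge0_integral_shift f (c : R) :
  measurable_fun [set: R] f -> (forall x, 0 <= f x) ->
  \int[mu]_x f x = \int[mu]_x f (c + x)%R.
Proof.
move=> mf f0.
pose phi : measurableTypeR R -> measurableTypeR R := +%R c.
have mphi : measurable_fun setT phi by apply: measurable_funD.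
pose nu := measure_function_pushforward__canonical__measure_function_Measure mu mphi.
have : \int[mu]_x f x = \int[nu]_x f x.
  apply: eq_measure_integral => A mA _.
  apply: lebesgue_measure_unique => //= _ [[a b]] _ <-.
  rewrite /pushforward/=.
  have -> : phi @^-1` `]a, b]%classic = `](a - c)%R, (b - c)%R]%classic.
    by apply/seteqP; split => x; rewrite /= !in_itv/= /phi lerBrDl ltrBlDl.
  rewrite !lebesgue_measure_itv/= !lte_fin ltrD2r.
  by case: ifPn => ab //; rewrite -!EFinB opprB addrA subrK.
by move=> ->; rewrite ge0_integral_pushforward.
Qed.

End haar.

(** Extending 1/t by 0 makes the density of dt/t total and nonnegative, so that Haar integrals run
    over the whole line without domain conditions. *)
Definition rinv {R : realType} (t : R) : R := if 0 < t then t^-1 else 0.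

Definition ge0_measurable {R : realType} (f : R -> \bar R) :=
  measurable_fun [set: R] f /\ forall x, (0 <= f x)%E.

Definition haar {R : realType} (f : R -> \bar R) : \bar R :=
  (\int[@lebesgue_measure R]_t (f t * (rinv t)%:E))%E.

(* The guard and [rinv] make [econv f g] vanish outside (0, +oo), whatever the
   values of [f] and [g] there. *)
Definition econv {R : realType} (f g : R -> \bar R) (x : R) : \bar R :=
  if 0 < x then haar (fun t => f t * g (x * rinv t)%R)%E else 0%E.

Section haar_theory.
Local Open Scope ereal_scope.
Context {R : realType}.
Local Notation mu := (@lebesgue_measure R).
Implicit Types (f g h : R -> \bar R) (c t x : R).

Lemma rinv_ge0 t : (0 <= rinv t)%R.
Proof. by rewrite /rinv; case: ifPn => // t0; rewrite invr_ge0 ltW. Qed.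

Lemma rinvE t : (0 < t)%R -> rinv t = (t^-1)%R.
Proof. by rewrite /rinv => ->. Qed.

Lemma rinv_gt0 t : (0 < t)%R -> (0 < rinv t)%R.
Proof. by move=> t0; rewrite rinvE// invr_gt0. Qed.

Lemma rinv_le0 t : (t <= 0)%R -> rinv t = 0%R.
Proof. by rewrite /rinv leNgt; case: ifP. Qed.

Lemma rinvK t : (0 < t)%R -> rinv (rinv t) = t.
Proof. by move=> t0; rewrite (rinvE (rinv_gt0 t0)) rinvE// invrK. Qed.

Lemma rinvM c t : (0 < c)%R -> rinv (c * t)%R = (c^-1 * rinv t)%R.
Proof.
move=> c0; rewrite /rinv pmulr_rgt0//; case: ifPn => t0; last by rewrite mulr0.
by rewrite invfM.
Qed.

Lemma measurable_rinv : measurable_fun [set: R] (@rinv R).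
Proof.
rewrite (_ : @rinv R = fun t => if (0 < t)%R then powR t (-1) else 0%R).
  by apply: measurable_fun_ifT => //; exact: measurable_fun_ltr.
by apply/funext => t; rewrite /rinv; case: ifPn => // t0; rewrite powR_inv1// ltW.
Qed.

Lemma measurable_rinv_comp d (T : measurableType d) (u : T -> R) :
  measurable_fun setT u -> measurable_fun setT (fun z => rinv (u z)).
Proof. by move=> mu_; exact: measurableT_comp measurable_rinv mu_. Qed.

Lemma eq_haar f g : (forall t, (0 < t)%R -> f t = g t) -> haar f = haar g.
Proof.
move=> fg; apply: eq_integral => t _.
have [t0|t0] := ltP 0%R t; first by rewrite fg.
by rewrite rinv_le0// !mule0.
Qed.

Lemma haar_ge0 f : (forall t, 0 <= f t) -> 0 <= haar f.
Proof.
by move=> f0; apply: integral_ge0 => t _; rewrite mule_ge0// lee_fin rinv_ge0.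
Qed.

Lemma ge0_measurableM f g : ge0_measurable f -> ge0_measurable g ->
  ge0_measurable (fun x => f x * g x).
Proof.
move=> [mf f0] [mg g0]; split; first exact: emeasurable_funM.
by move=> x; rewrite mule_ge0.
Qed.

Lemma ge0_measurable_comp f (u : R -> R) : ge0_measurable f ->
  measurable_fun [set: R] u -> ge0_measurable (f \o u).
Proof. by move=> [mf f0] mu_; split => [|x]; [exact: measurableT_comp|exact: f0]. Qed.

Lemma ge0_measurable_rinv : ge0_measurable (fun t : R => (rinv t)%:E).
Proof.
split; last by move=> t; rewrite lee_fin rinv_ge0.
by apply/measurable_EFinP; exact: measurable_rinv.
Qed.

Lemma haarZl f (k : \bar R) : ge0_measurable f -> 0 <= k ->
  haar (fun t => k * f t) = k * haar f.
Proof.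
move=> mf k0; rewrite /haar -ge0_integralZl//.
- by apply: eq_integral => t _; rewrite muleA.
- by have [] := ge0_measurableM mf ge0_measurable_rinv.
- by move=> t _; have [_] := ge0_measurableM mf ge0_measurable_rinv.
Qed.

Lemma haarZr f (k : \bar R) : ge0_measurable f -> 0 <= k ->
  haar (fun t => f t * k) = haar f * k.
Proof.
by move=> mf k0; rewrite muleC -haarZl//; apply: eq_haar => t _; rewrite muleC.
Qed.

(** The factor c from Lebesgue measure cancels the factor 1/c from the density. *)
Lemma haar_scale f c : ge0_measurable f -> (0 < c)%R ->
  haar (fun t => f (c * t)%R) = haar f.
Proof.
move=> mf c0; rewrite /haar [RHS](@ge0_integral_scale _ _ c)//; last 2 first.
- by have [] := ge0_measurableM mf ge0_measurable_rinv.
- by have [] := ge0_measurableM mf ge0_measurable_rinv.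
have mfc : ge0_measurable (fun t => f (c * t)%R).
  by apply: (ge0_measurable_comp mf); exact: mulrl_measurable.
have [mfr fr0] := ge0_measurableM mfc
  (ge0_measurable_comp ge0_measurable_rinv (mulrl_measurable c)).
rewrite -ge0_integralZl ?lee_fin ?ltW//.
apply: eq_integral => t _; rewrite rinvM// EFinM muleCA; congr (_ * _).
by rewrite /= -EFinM mulrA divff ?mul1r// gt_eqF.
Qed.

Lemma haar_fubini (F : R -> R -> \bar R) :
  measurable_fun [set: R * R] (fun p => F p.1 p.2) -> (forall s t, 0 <= F s t) ->
  haar (fun s => haar (F s)) = haar (fun t => haar (F ^~ t)).
Proof.
move=> mF F0.
pose G p := F p.1 p.2 * (rinv p.1)%:E * (rinv p.2)%:E.
have mG : measurable_fun [set: R * R] G.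
  by apply: emeasurable_funM; [apply: emeasurable_funM => //|];
    apply/measurable_EFinP; apply: measurable_rinv_comp;
    [exact: measurable_fst|exact: measurable_snd].
have mF1 s : measurable_fun [set: R] (F s).
  exact: (measurableT_comp mF (pair1_measurable s)).
have mF2 t : measurable_fun [set: R] (F ^~ t).
  exact: (measurableT_comp mF (pair2_measurable t)).
transitivity (\int[mu]_s \int[mu]_t G (s, t)).
  apply: eq_integral => s _; rewrite /haar -ge0_integralZr ?lee_fin ?rinv_ge0//.
  - by apply: eq_integral => t _; rewrite /G/= muleAC.
  - by have [] := ge0_measurableM (conj (mF1 s) (F0 s)) ge0_measurable_rinv.
  - move=> t _.
    by have [] := ge0_measurableM (conj (mF1 s) (F0 s)) ge0_measurable_rinv.
rewrite fubini_tonelli//; last first.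
  by move=> p; rewrite /G !mule_ge0// lee_fin rinv_ge0.
apply: eq_integral => t _; rewrite /haar -ge0_integralZr ?lee_fin ?rinv_ge0//.
- by have [] := ge0_measurableM (conj (mF2 t) (F0 ^~ t)) ge0_measurable_rinv.
- move=> s _.
  by have [] := ge0_measurableM (conj (mF2 t) (F0 ^~ t)) ge0_measurable_rinv.
Qed.

Lemma measurable_haar (F : R -> R -> \bar R) :
  measurable_fun [set: R * R] (fun p => F p.1 p.2) -> (forall s t, 0 <= F s t) ->
  ge0_measurable (fun s => haar (F s)).
Proof.
move=> mF F0; split; last by move=> s; exact: haar_ge0.
apply: (@measurable_fun_fubini_tonelli_F _ _ _ _ _ mu (fun p => F p.1 p.2 * (rinv p.2)%:E)).
  apply: emeasurable_funM => //; apply/measurable_EFinP; apply: measurable_rinv_comp.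
  exact: measurable_snd.
by move=> p; rewrite mule_ge0// lee_fin rinv_ge0.
Qed.

End haar_theory.

(** * Multiplicative convolution *)

Section econv_theory.
Local Open Scope ereal_scope.
Context {R : realType}.
Local Notation mu := (@lebesgue_measure R).
Implicit Types (f g h : R -> \bar R) (c t x : R).

Lemma measurable_comp1 f (u : R * R -> R) : ge0_measurable f ->
  measurable_fun [set: R * R] u -> measurable_fun [set: R * R] (fun p => f (u p)).
Proof. by move=> [mf _] mu_; exact: measurableT_comp mf mu_. Qed.

Lemma measurable_mul_rinv1 :
  measurable_fun [set: R * R] (fun p => p.1 * rinv p.2)%R.
Proof.
apply: measurable_funM; first exact: measurable_fst.
by apply: measurable_rinv_comp; exact: measurable_snd.
Qed.

(* Uniqueness of Haar measure: for a probability density [psi], compute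
   [\int \int f(1/t) psi(t s) ds/s dt/t] in two ways, using only invariance
   under scaling. *)
Lemma haar_inv f : ge0_measurable f -> haar (fun t => f (rinv t)) = haar f.
Proof.
move=> mf.
(* The factor t cancels the density 1/t, so the Haar mass of [psi] is the length of (0, 1). *)
pose psi t := (t * \1_(`]0%R, 1%R[%classic : set R) t)%:E.
have mpsi : ge0_measurable psi.
  split.
    by apply/measurable_EFinP/measurable_funM => //; exact: measurable_indic.
  move=> t; rewrite lee_fin /psi indicE.
  have [|_] := boolP (t \in _); last by rewrite mulr0.
  by rewrite inE/= in_itv/= => /andP[t0 _]; rewrite mulr1 ltW.
have hpsi : haar psi = 1.
  transitivity (\int[mu]_t (\1_(`]0%R, 1%R[%classic : set R) t)%:E).
    apply: eq_integral => t _; rewrite /psi -EFinM indicE.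
    have [|_] := boolP (t \in _); last by rewrite mulr0 mul0r.
    rewrite inE/= in_itv/= => /andP[t0 _].
    by rewrite mulr1 rinvE// divff// gt_eqF.
  rewrite integral_indic// setIT; apply: etrans (lebesgue_measure_itv _) _.
  by rewrite /= lte_fin ltr01 sube0.
have mfi : ge0_measurable (f \o (@rinv R)).
  by apply: ge0_measurable_comp => //; exact: measurable_rinv.
pose F t s := f (rinv t) * psi (t * s)%R.
have mF : measurable_fun [set: R * R] (fun p => F p.1 p.2).
  apply: emeasurable_funM.
    apply: (measurable_comp1 mf); apply: measurable_rinv_comp.
    exact: measurable_fst.
  apply: (measurable_comp1 mpsi); apply: measurable_funM.
    exact: measurable_fst.
  exact: measurable_snd.
pose G s t := f (s * rinv t)%R * psi t.
have mG : measurable_fun [set: R * R] (fun p => G p.1 p.2).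
  apply: emeasurable_funM.
    by apply: (measurable_comp1 mf); exact: measurable_mul_rinv1.
  by apply: (measurable_comp1 mpsi); exact: measurable_snd.
have f0 := mf.2; have psi0 := mpsi.2.
transitivity (haar (fun t => haar (F t))).
  apply: eq_haar => t t0; rewrite haarZl//; last first.
    by apply: (ge0_measurable_comp mpsi); exact: mulrl_measurable.
  by rewrite haar_scale// hpsi mule1.
rewrite haar_fubini//; last by move=> s t; rewrite mule_ge0.
transitivity (haar (fun s => haar (G s))).
  (* Replacing t by t/s frees [psi] of s and turns f(1/t) into f(s/t), whose integral over s is
     again that of f. *)
  apply: eq_haar => s s0; rewrite -(@haar_scale _ _ (s^-1)%R) ?invr_gt0//.
    apply: eq_haar => t t0; rewrite /F /G rinvM ?invr_gt0// invrK.
    by rewrite mulrAC mulVf ?mul1r// gt_eqF.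
  split; last by move=> t; rewrite mule_ge0.
  exact: (measurableT_comp mF (pair2_measurable s)).
rewrite haar_fubini//; last by move=> s t; rewrite mule_ge0.
rewrite -[RHS]mule1 -hpsi -haarZl//; last exact: haar_ge0.
apply: eq_haar => t t0; rewrite haarZr//.
  under eq_haar do rewrite mulrC.
  by rewrite haar_scale// rinv_gt0.
by apply: (ge0_measurable_comp mf); exact: mulrr_measurable.
Qed.

Lemma econvE f g x : (0 < x)%R ->
  econv f g x = haar (fun t => f t * g (x * rinv t)%R).
Proof. by rewrite /econv => ->. Qed.

Lemma ge0_measurable_econv f g : ge0_measurable f -> ge0_measurable g ->
  ge0_measurable (econv f g).
Proof.
move=> mf mg.
have [mh h0] : ge0_measurable (fun x => haar (fun t => f t * g (x * rinv t)%R)).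
  apply: (@measurable_haar _ (fun x t => f t * g (x * rinv t)%R)).
    apply: emeasurable_funM.
      by apply: (measurable_comp1 mf); exact: measurable_snd.
    by apply: (measurable_comp1 mg); exact: measurable_mul_rinv1.
  by move=> s t; rewrite mule_ge0// ?mf.2// mg.2.
split; last by move=> x; rewrite /econv; case: ifP.
by apply: measurable_fun_ifT => //; exact: measurable_fun_ltr.
Qed.

(** The substitution of x/t for t, an inversion followed by a scaling, exchanges the two factors. *)
Lemma econvC f g : ge0_measurable f -> ge0_measurable g -> econv f g = econv g f.
Proof.
move=> mf mg; apply/funext => x; rewrite /econv; case: ifPn => // x0.
pose F t := f t * g (x * rinv t)%R.
have mF : ge0_measurable F.
  apply: ge0_measurableM => //; apply: (ge0_measurable_comp mg).
  by apply: measurable_funM => //; exact: measurable_rinv.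
rewrite -[LHS](haar_inv mF) -(@haar_scale _ _ (x^-1)%R) ?invr_gt0//; last first.
  by apply: (ge0_measurable_comp mF); exact: measurable_rinv.
apply: eq_haar => t t0; rewrite /F rinvM ?invr_gt0// invrK muleC; congr (g _ * _).
have xt : (0 < x * rinv t)%R by rewrite mulr_gt0// rinv_gt0.
by rewrite rinvM// rinvK// mulrA divff ?mul1r// gt_eqF.
Qed.

(** Tonelli's theorem, then the scaling of the outer variable by t. The identity holds at every
    point because the value +oo is allowed. *)
Lemma econvA f g h : ge0_measurable f -> ge0_measurable g -> ge0_measurable h ->
  econv (econv f g) h = econv f (econv g h).
Proof.
move=> mf mg mh; apply/funext => x; rewrite /econv; case: ifPn => // x0.
have [f0 g0 h0] := And3 mf.2 mg.2 mh.2.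
have ms (k : R -> \bar R) (y : R) : ge0_measurable k ->
    ge0_measurable (fun t => k (y * rinv t)%R).
  move=> mk; apply: (ge0_measurable_comp mk); apply: measurable_funM => //.
  exact: measurable_rinv.
pose F s t := f t * g (s * rinv t)%R * h (x * rinv s)%R.
transitivity (haar (fun s => haar (F s))).
  apply: eq_haar => s s0; rewrite s0 haarZr//.
  by apply: ge0_measurableM => //; exact: ms.
have mF : measurable_fun [set: R * R] (fun p => F p.1 p.2).
  apply: emeasurable_funM; [apply: emeasurable_funM|].
  - by apply: (measurable_comp1 mf); exact: measurable_snd.
  - by apply: (measurable_comp1 mg); exact: measurable_mul_rinv1.
  - apply: (measurable_comp1 mh); apply: measurable_funM => //.
    by apply: measurable_rinv_comp; exact: measurable_fst.
rewrite haar_fubini//; last by move=> s t; rewrite !mule_ge0.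
apply: eq_haar => t t0.
have xt : (0 < x * rinv t)%R by rewrite mulr_gt0// rinv_gt0.
rewrite xt -haarZl//; last first.
  by apply: ge0_measurableM => //; exact: ms.
rewrite -(@haar_scale _ _ t)//; last first.
  split; last by move=> s; rewrite !mule_ge0.
  exact: (measurableT_comp mF (pair2_measurable t)).
apply: eq_haar => s s0; rewrite /F rinvM// (rinvE t0) muleA; congr (_ * g _ * h _).
  by rewrite mulrAC divff ?mul1r// gt_eqF.
by rewrite mulrA.
Qed.

Lemma haar_econv f g : ge0_measurable f -> ge0_measurable g ->
  haar (econv f g) = haar f * haar g.
Proof.
move=> mf mg; have [f0 g0] := (mf.2, mg.2).
transitivity (haar (fun x => haar (fun t => f t * g (x * rinv t)%R))).
  by apply: eq_haar => x x0; rewrite econvE.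
rewrite haar_fubini//; last 2 first.
- apply: emeasurable_funM.
    by apply: (measurable_comp1 mf); exact: measurable_snd.
  by apply: (measurable_comp1 mg); exact: measurable_mul_rinv1.
- by move=> s t; rewrite mule_ge0.
rewrite -haarZr//; last exact: haar_ge0.
apply: eq_haar => t t0; rewrite haarZl//; last first.
  by apply: (ge0_measurable_comp mg); exact: mulrr_measurable.
congr (_ * _); under eq_haar do rewrite mulrC.
by rewrite haar_scale// rinv_gt0.
Qed.

(* [haar (pweight s f)] is the Mellin transform of [f] at [s]. *)
Definition pweight (s : R) f : R -> \bar R := fun x => (x `^ s)%:E * f x.

Lemma ge0_measurable_pweight s f :
  ge0_measurable f -> ge0_measurable (pweight s f).
Proof.
move=> mf; apply: ge0_measurableM => //; split; last by move=> x; rewrite lee_fin powR_ge0.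
by apply/measurable_EFinP; exact: measurable_powR.
Qed.

(** Powers are characters of the multiplicative group: x^s = t^s (x/t)^s. This makes the Mellin
    transform multiplicative. *)
Lemma pweight_econv s f g x : ge0_measurable f -> ge0_measurable g ->
  pweight s (econv f g) x = econv (pweight s f) (pweight s g) x.
Proof.
move=> mf mg; rewrite /pweight /econv; case: ifPn => x0; last by rewrite mule0.
rewrite -haarZl ?lee_fin ?powR_ge0//; last first.
  apply: ge0_measurableM => //; apply: (ge0_measurable_comp mg).
  by apply: measurable_funM => //; exact: measurable_rinv.
apply: eq_haar => t t0; rewrite [RHS]muleACA; congr (_ * _).
rewrite -EFinM -powRM ?ltW//; last by rewrite mulr_gt0// rinv_gt0.
by rewrite rinvE// mulrCA divff ?mulr1// gt_eqF.
Qed.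

Lemma haar_pweight_econv s f g : ge0_measurable f -> ge0_measurable g ->
  haar (pweight s (econv f g)) = haar (pweight s f) * haar (pweight s g).
Proof.
move=> mf mg; rewrite -haar_econv; [|exact: ge0_measurable_pweight..].
by apply: eq_haar => x _; rewrite pweight_econv.
Qed.

End econv_theory.

(** * Power and exponential kernels *)

Section powR_aux.
Context {R : realType}.
Implicit Types (a b c x t : R).

Lemma powR_expR x a : 0 < x -> x `^ a = expR (a * ln x).
Proof. by move=> x0; rewrite /powR gt_eqF. Qed.

Lemma cvg_powRN c : 0 < c -> x `^ (- c) @[x --> +oo] --> 0.
Proof.
move=> c0; apply/cvgrPdist_le => e e0; near=> x.
have x0 : 0 < x by near: x; exact: nbhs_pinfty_gt.
rewrite sub0r normrN ger0_norm ?powR_ge0// powRN.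
rewrite -[leRHS]invrK lef_pV2 ?posrE ?powR_gt0 ?invr_gt0//.
have -> : e^-1 = (e `^ (- c^-1)) `^ c.
  by rewrite -powRrM mulNr mulVf ?gt_eqF// powR_inv1// ltW.
apply: ge0_ler_powR; rewrite ?nnegrE ?powR_ge0 ?ltW//.
Unshelve. all: by end_near. Qed.

End powR_aux.

Section kernels.
Local Open Scope ereal_scope.
Context {R : realType}.
Local Notation mu := (@lebesgue_measure R).
Implicit Types (a b c d s t x y : R).

(** The beta kernel with parameters b and b + 1, as Gamma(1) = 1; its Mellin transform at s is 1/(s
    + b). *)
Definition pow_kernel b x : \bar R :=
  if ((0 < x) && (x < 1))%R then (x `^ b)%:E else 0.

(** The Gamma density: its Mellin transform at s is Gamma(s + b). *)
Definition exp_kernel b x : \bar R :=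
  if (0 < x)%R then (x `^ b * expR (- x))%:E else 0.

Lemma ge0_measurable_if (p : R -> bool) (f : R -> R) :
  measurable_fun [set: R] p -> measurable_fun [set: R] f ->
  (forall x, p x -> (0 <= f x)%R) ->
  ge0_measurable (fun x => if p x then (f x)%:E else 0).
Proof.
move=> mp mf f0; split; last by move=> x; case: ifPn => // /f0; rewrite lee_fin.
by apply: measurable_fun_ifT => //; exact/measurable_EFinP.
Qed.

Lemma measurable_gtr x : measurable_fun [set: R] (fun t => x < t)%R.
Proof. exact: measurable_fun_ltr. Qed.

Lemma measurable_ltr x : measurable_fun [set: R] (fun t => t < x)%R.
Proof. exact: measurable_fun_ltr. Qed.

Lemma measurable_expRN : measurable_fun [set: R] (fun t => expR (- t))%R.
Proof. by apply: measurableT_comp => //; exact: oppr_measurable. Qed.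

Lemma ge0_measurable_pow_kernel b : ge0_measurable (pow_kernel b).
Proof.
apply: ge0_measurable_if; last by move=> x _; exact: powR_ge0.
  by apply: measurable_and; [exact: measurable_gtr|exact: measurable_ltr].
exact: measurable_powR.
Qed.

Lemma ge0_measurable_exp_kernel b : ge0_measurable (exp_kernel b).
Proof.
apply: ge0_measurable_if; last by move=> x _; rewrite mulr_ge0 ?powR_ge0 ?expR_ge0.
  exact: measurable_gtr.
by apply: measurable_funM; [exact: measurable_powR|exact: measurable_expRN].
Qed.

Lemma integral_itv0y (f : R -> \bar R) :
  \int[mu]_(t in `]0%R, +oo[) f t = haar (fun t => t%:E * f t).
Proof.
rewrite integral_mkcond; apply: eq_integral => t _; rewrite patchE.
have [t0|t0] := ltP 0%R t.
  rewrite mem_set /= ?in_itv/= ?t0// muleC muleA rinvE// -EFinM mulVf ?gt_eqF//.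
  by rewrite mul1e.
by rewrite rinv_le0// mule0 memNset//= in_itv/= andbT; apply/negP; rewrite -leNgt.
Qed.

(** A convolution at x with a kernel supported in (0, 1) sees only t > x. Once a factor t cancels
    the density 1/t, translation by x turns it into a Lebesgue integral over (0, +oo). *)
Lemma haar_shift x (u : R -> \bar R) : (0 <= x)%R -> ge0_measurable u ->
  haar (fun t => if (x < t)%R then t%:E * u (t - x)%R else 0) =
  haar (fun t => t%:E * u t).
Proof.
move=> x0 [mu_ u0].
pose v t := if (x < t)%R then u (t - x)%R else 0.
transitivity (\int[mu]_t v t).
  apply: eq_integral => t _; rewrite /v; case: ifPn => xt; last by rewrite mul0e.
  have t0 := le_lt_trans x0 xt.
  by rewrite muleC muleA rinvE// -EFinM mulVf ?gt_eqF// mul1e.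
rewrite (@ge0_integral_shift _ _ x); last 2 first.
- apply: measurable_fun_ifT => //; first exact: measurable_gtr.
  by apply: (measurableT_comp mu_); exact: measurable_funB.
- by move=> t; rewrite /v; case: ifP.
rewrite -integral_itv0y [RHS]integral_mkcond; apply: eq_integral => t _.
rewrite patchE /v ltrDl addrC addKr.
case: ifPn => t0; first by rewrite mem_set//= in_itv/= t0.
by rewrite memNset//= in_itv/= andbT; exact/negP.
Qed.

(** Inversion moves the possible singularity at 0 to infinity, where the fundamental theorem of
    calculus on [1, +oo) applies. *)
Lemma haar_pow_kernel c : (0 < c)%R -> haar (pow_kernel c) = (c^-1)%:E.
Proof.
move=> c0; rewrite -(haar_inv (ge0_measurable_pow_kernel c)).
transitivity (\int[mu]_(t in `]1%R, +oo[) (t `^ (- c - 1))%:E).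
  rewrite integral_mkcond; apply: eq_integral => t _; rewrite patchE /pow_kernel.
  have [t0|t0] := ltP 0%R t; last first.
    rewrite rinv_le0// mule0 memNset//= in_itv/= andbT; apply/negP; rewrite -leNgt.
    exact: le_trans t0 ler01.
  rewrite rinv_gt0// rinvE// invf_lt1//=; case: ifPn => t1.
    rewrite mem_set/= ?in_itv/= ?t1// -EFinM; congr EFin.
    rewrite -(powR_inv1 (ltW t0)) -powRrM -powRD; first by congr (_ `^ _)%R; ring.
    by rewrite (gt_eqF t0) implybT.
  by rewrite memNset ?mul0e//= in_itv/= andbT; exact/negP.
have d1 x : (0 < x)%R -> is_derive x 1%R (fun t => - c^-1 * t `^ (- c))%R (x `^ (- c - 1))%R.
  move=> x0.
  have x0' : x \in `]0%R, +oo[ by rewrite in_itv/= x0.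
  have := @derivable_powR R 1%R (- c)%R x x0' => /derivableP.
  rewrite -derive1E powR_derive1// => H.
  have -> : (x `^ (- c - 1) = - c^-1 *: (- c * x `^ (- c - 1)) :> R)%R.
    by rewrite /GRing.scale/= mulrA mulrNN mulVf ?mul1r// gt_eqF.
  exact: is_deriveZ.
have cont x : (0 < x)%R -> {for x, continuous (fun t => - c^-1 * t `^ (- c))%R}.
  move=> x0; apply: differentiable_continuous; apply/derivable1_diffP.
  by have [] := d1 _ x0.
have contf x : (0 < x)%R -> {for x, continuous (fun t => t `^ (- c - 1))%R}.
  move=> x0; apply: differentiable_continuous; apply/derivable1_diffP.
  by apply: derivable_powR; rewrite in_itv/= x0.
rewrite integral_itv_obnd_cbnd; last first.
  by apply/measurable_EFinP; apply: measurable_funTS; exact: measurable_powR.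
rewrite (@ge0_continuous_FTC2y _ _ (fun t => - c^-1 * t `^ (- c))%R _ 0%R).
- by rewrite powR1 mulr1 sub0e -EFinN opprK.
- by move=> x _; exact: powR_ge0.
- apply: continuous_in_subspaceT => x; rewrite inE/= in_itv/= andbT => x1.
  exact: contf (lt_le_trans ltr01 x1).
- rewrite -(mulr0 (- c^-1)%R); apply: cvgMr.
  exact: cvg_powRN.
- by move=> x x1; have [] := d1 _ (lt_trans ltr01 x1).
- by apply: cvg_at_right_filter; exact: cont.
- move=> x; rewrite in_itv/= andbT => x1; rewrite derive1E.
  by have [_ ->] := d1 _ (lt_trans ltr01 x1).
Qed.

Lemma haar_exp_kernel1 : haar (exp_kernel 1) = 1.
Proof.
transitivity (\int[mu]_(t in `]0%R, +oo[) (expR (- t))%:E).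
  rewrite integral_itv0y; apply: eq_haar => t t0.
  by rewrite /exp_kernel t0 powRr1 ?ltW.
rewrite integral_itv_obnd_cbnd; last first.
  by apply/measurable_EFinP; apply: measurable_funTS; exact: measurable_expRN.
have d1 x : is_derive x 1%R (fun t => - expR (- t))%R (expR (- x))%R.
  apply: is_derive_eq.
  by rewrite mulrN1 opprK.
have cont (x : R) : {for x, continuous (fun t => - expR (- t))%R}.
  apply: differentiable_continuous; apply/derivable1_diffP.
  by have [] := d1 x.
rewrite (@ge0_continuous_FTC2y _ _ (fun t => - expR (- t))%R _ 0%R).
- by rewrite oppr0 expR0 sub0e -EFinN opprK.
- by move=> x _; exact: expR_ge0.
- apply: continuous_in_subspaceT => x _.
  apply: (@continuous_comp _ _ _ -%R expR); first exact: opp_continuous.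
  exact: continuous_expR.
- by rewrite -oppr0; apply: cvgN; exact: cvgr_expR.
- by move=> x _; have [] := d1 x.
- by apply: cvg_at_right_filter; exact: cont.
- by move=> x _; rewrite derive1E; have [_ ->] := d1 x.
Qed.

End kernels.

(** * The Gamma function and the beta kernels *)

Section gamma.
Local Open Scope ereal_scope.
Context {R : realType}.
Local Notation mu := (@lebesgue_measure R).
Implicit Types (a b c d s t x y : R).

Lemma exp_kernelE b x : (0 < x)%R -> exp_kernel b x = (x `^ b * expR (- x))%:E.
Proof. by rewrite /exp_kernel => ->. Qed.

(* After taking Haar integrals, the functional equation of Gamma. *)
Lemma econv_exp_kernel_pow b :
  econv (exp_kernel (b + 1)) (pow_kernel b) = exp_kernel b.
Proof.
apply/funext => x; rewrite /econv; case: ifPn => x0; last first.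
  by rewrite /exp_kernel (negbTE x0).
rewrite exp_kernelE//.
pose u t : \bar R := (x `^ b * expR (- x))%:E * (expR (- t))%:E.
have mexp : ge0_measurable (fun t : R => (expR (- t))%:E).
  split; first by apply/measurable_EFinP; exact: measurable_expRN.
  by move=> t; rewrite lee_fin expR_ge0.
have c0 : 0 <= (x `^ b * expR (- x))%:E.
  by rewrite lee_fin mulr_ge0 ?powR_ge0 ?expR_ge0.
transitivity (haar (fun t => if (x < t)%R then t%:E * u (t - x)%R else 0)).
  apply: eq_haar => t t0; rewrite exp_kernelE// /pow_kernel rinvE//.
  rewrite ltr_pdivrMr// mul1r; case: (ifP (x < t)%R) => xt.
    rewrite divr_gt0//= /u -!EFinM; congr EFin.
    rewrite !powR_expR ?divr_gt0// ln_div ?posrE//.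
    rewrite -{4}(lnK (t0 : t \is Num.pos)) -!expRD; congr expR; ring.
  by rewrite andbF mule0.
rewrite haar_shift ?ltW//; last first.
  split; last by move=> t; rewrite mule_ge0// mexp.2.
  by apply: measurable_funeM; exact: mexp.1.
transitivity (haar (fun t => (x `^ b * expR (- x))%:E * exp_kernel 1 t)).
  apply: eq_haar => t t0; rewrite exp_kernelE// powRr1 ?ltW// /u muleCA.
  by rewrite EFinM.
rewrite haarZl//; last exact: ge0_measurable_exp_kernel.
by rewrite haar_exp_kernel1 mule1.
Qed.

Lemma pweight_exp_kernel s b : pweight s (exp_kernel b) = exp_kernel (s + b).
Proof.
apply/funext => x; rewrite /pweight /exp_kernel; case: ifPn => x0; last by rewrite mule0.
by rewrite -EFinM mulrA -powRD// (gt_eqF x0) implybT.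
Qed.

Lemma haar_exp_kernel_rec b : (0 < b)%R ->
  haar (exp_kernel b) = haar (exp_kernel (b + 1)) * (b^-1)%:E.
Proof.
move=> b0; rewrite -econv_exp_kernel_pow haar_econv ?haar_pow_kernel//.
  exact: ge0_measurable_exp_kernel.
exact: ge0_measurable_pow_kernel.
Qed.

Lemma haar_exp_kernelS n : haar (exp_kernel (n.+1%:R : R)) < +oo.
Proof.
elim: n => [|n ih]; first by rewrite haar_exp_kernel1 ltry.
move: ih; rewrite haar_exp_kernel_rec// natr1.
have := haar_ge0 (@ge0_measurable_exp_kernel R n.+2%:R).2.
case: (haar _) => [r _ _||//]; first exact: ltry.
by move=> _; rewrite gt0_mulye// lte_fin invr_gt0.
Qed.

Lemma haarD (f g : R -> \bar R) : ge0_measurable f -> ge0_measurable g ->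
  haar (fun t => f t + g t) = haar f + haar g.
Proof.
move=> mf mg; rewrite /haar -ge0_integralD//.
- by apply: eq_integral => t _; rewrite ge0_muleDl ?mf.2 ?mg.2.
- by move=> t _; exact: (ge0_measurableM mf ge0_measurable_rinv).2.
- exact: (ge0_measurableM mf ge0_measurable_rinv).1.
- by move=> t _; exact: (ge0_measurableM mg ge0_measurable_rinv).2.
- exact: (ge0_measurableM mg ge0_measurable_rinv).1.
Qed.

Lemma le_haar (f g : R -> \bar R) : ge0_measurable f -> ge0_measurable g ->
  (forall t, (0 < t)%R -> f t <= g t) -> haar f <= haar g.
Proof.
move=> mf mg fg; apply: ge0_le_integral => //.
- by move=> t _; exact: (ge0_measurableM mf ge0_measurable_rinv).2.
- exact: (ge0_measurableM mf ge0_measurable_rinv).1.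
- exact: (ge0_measurableM mg ge0_measurable_rinv).1.
- move=> t _; have [t0|t0] := ltP 0%R t.
    by apply: lee_wpmul2r; rewrite ?fg// lee_fin rinv_ge0.
  by rewrite rinv_le0// !mule0.
Qed.

(** Positive integers are reached by the recurrence from 1. For c >= 1, t^c is at most t + t^(n+1)
    with n + 1 >= c. An exponent below 1 follows from b + 1 by the recurrence. *)
Lemma haar_exp_kernel_lty b : (0 < b)%R -> haar (exp_kernel b) < +oo.
Proof.
move=> b0.
have large c : (1 <= c)%R -> haar (exp_kernel c) < +oo.
  move=> c1; have [n cn] : exists n, (c <= n.+1%:R)%R.
    by exists (Num.truncn c); exact/ltW/truncnS_gt.
  have m := @ge0_measurable_exp_kernel R.
  apply: (@le_lt_trans _ _ (haar (fun t => exp_kernel 1 t + exp_kernel n.+1%:R t))).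
    apply: le_haar => //.
      split; first by apply: emeasurable_funD; exact: (m _).1.
      by move=> t; rewrite adde_ge0 ?(m _).2.
    move=> t t0; rewrite !exp_kernelE// -EFinD lee_fin -mulrDl.
    apply: ler_wpM2r; first exact: expR_ge0.
    have [t1|/ltW t1] := leP t 1%R.
      by apply: ler_wpDr; [exact: powR_ge0|apply: ger_powR; rewrite ?t0].
    by apply: ler_wpDl; [exact: powR_ge0|exact: ler_powR].
  rewrite (haarD (m 1%R) (m _)) haar_exp_kernel1.
  by apply: lte_add_pinfty; [exact: ltry|exact: haar_exp_kernelS].
rewrite haar_exp_kernel_rec//.
have := large (b + 1)%R; rewrite lerDr (ltW b0) => /(_ isT).
have := haar_ge0 (ge0_measurable_exp_kernel (b + 1)).2.
by case: (haar _) => [r _ _||//]; first exact: ltry.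
Qed.

Lemma haar_exp_kernel_gt0 b : (0 < b)%R -> 0 < haar (exp_kernel b).
Proof.
move=> b0; have m := @ge0_measurable_exp_kernel R b.
(* On (0, 1) the exponential is at least e^(-1), which bounds the integral below by a multiple of
   that of [pow_kernel b]. *)
pose f t : \bar R := (expR (-1))%:E * pow_kernel b t.
have mf : ge0_measurable f.
  have mp := ge0_measurable_pow_kernel b.
  split; first by apply: measurable_funeM; exact: mp.1.
  by move=> t; rewrite mule_ge0 ?mp.2// lee_fin expR_ge0.
apply: (@lt_le_trans _ _ (haar f)).
  rewrite haarZl ?lee_fin ?expR_ge0//; last exact: ge0_measurable_pow_kernel.
  by rewrite haar_pow_kernel// -EFinM lte_fin mulr_gt0 ?expR_gt0// invr_gt0.
apply: le_haar => // t t0; rewrite exp_kernelE// /f /pow_kernel t0/=.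
case: ifPn => t1; last by rewrite mule0 lee_fin mulr_ge0 ?powR_ge0 ?expR_ge0.
by rewrite -EFinM lee_fin mulrC ler_wpM2l ?powR_ge0// ler_expR lerN2 ltW.
Qed.

Lemma GammaE b : (0 < b)%R -> (Gamma b)%:E = haar (exp_kernel b).
Proof.
move=> b0.
have E : haar (exp_kernel b) =
    \int[mu]_(t in `]0%R, +oo[) (t `^ (b - 1) * expR (- t))%:E.
  rewrite integral_itv0y; apply: eq_haar => t t0; rewrite exp_kernelE// -EFinM mulrA.
  by rewrite mulr_powRB1// ltW.
rewrite /Gamma /Rintegral -E fineK// ge0_fin_numE; first exact: haar_exp_kernel_lty.
exact: haar_ge0 (ge0_measurable_exp_kernel b).2.
Qed.

Lemma Gamma_gt0 b : (0 < b)%R -> (0 < Gamma b)%R.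
Proof. by move=> b0; rewrite -lte_fin GammaE// haar_exp_kernel_gt0. Qed.

Lemma GammaS b : (0 < b)%R -> Gamma (b + 1)%R = (b * Gamma b)%R.
Proof.
move=> b0; have /eqP := haar_exp_kernel_rec b0.
rewrite -!GammaE ?addr_gt0// -EFinM eqe => /eqP ->.
by rewrite mulrCA mulfV ?mulr1// gt_eqF.
Qed.

Lemma beta_kernel_ge0 a b x : (a < b)%R -> (0 <= beta_kernel a b x)%R.
Proof.
move=> ab; rewrite /beta_kernel; case: ifPn => // /andP[x0 x1].
by rewrite divr_ge0 ?mulr_ge0 ?powR_ge0// ltW// Gamma_gt0// subr_gt0.
Qed.

Lemma ge0_measurable_beta_kernel a b : (a < b)%R ->
  ge0_measurable (fun x => (beta_kernel a b x)%:E).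
Proof.
move=> ab; split; last by move=> x; rewrite lee_fin beta_kernel_ge0.
apply/measurable_EFinP; apply: measurable_fun_ifT => //.
  by apply: measurable_and; [exact: measurable_gtr|exact: measurable_ltr].
apply: measurable_funM => //; apply: measurable_funM; first exact: measurable_powR.
apply: (measurableT_comp (@measurable_powR R _)).
exact: measurable_funB.
Qed.

(** The powers of t add up to b - a - (b - a - 1) = 1: the single factor t that [haar_shift]
    requires. *)
Let beta_kernel_shift a b x t : (a < b)%R -> (0 < x)%R -> (0 < t)%R ->
  (t `^ b * beta_kernel a b (x * rinv t))%R =
  if (x < t)%R then (t * (x `^ a / Gamma (b - a) * (t - x) `^ (b - a - 1)))%R else 0%R.
Proof.
move=> ab x0 t0; rewrite /beta_kernel rinvE// divr_gt0//= ltr_pdivrMr// mul1r.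
case: ifPn => xt; last by rewrite mulr0.
have -> : (1 - x / t = (t - x) / t)%R by rewrite mulrBl divff// gt_eqF.
have tx0 : (0 < t - x)%R by rewrite subr_gt0.
rewrite !powR_expR ?divr_gt0// !ln_div ?posrE//.
rewrite -[X in _ = (X * _)%R](lnK (t0 : t \is Num.pos)).
set G := ((Gamma _)^-1)%R.
transitivity (G * (expR (b * ln t) * (expR (a * (ln x - ln t)) *
  expR ((b - a - 1) * (ln (t - x) - ln t)))))%R; first by ring.
transitivity (G * (expR (ln t) * (expR (a * ln x) *
  expR ((b - a - 1) * ln (t - x)))))%R; last by ring.
by congr (_ * _)%R; rewrite -!expRD; congr expR; ring.
Qed.

(** After translation by x the exponential splits as e^(-x) e^(-t), and the remaining integral is
    Gamma(b - a), the normalizing constant of the beta kernel. *)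
Lemma econv_exp_kernel_beta a b : (a < b)%R ->
  econv (exp_kernel b) (fun x => (beta_kernel a b x)%:E) = exp_kernel a.
Proof.
move=> ab; apply/funext => x; rewrite /econv; case: ifPn => x0; last first.
  by rewrite /exp_kernel (negbTE x0).
have ba0 : (0 < b - a)%R by rewrite subr_gt0.
pose k := (x `^ a / Gamma (b - a) * expR (- x))%R.
have k0 : (0 <= k)%R.
  by rewrite mulr_ge0 ?expR_ge0// divr_ge0 ?powR_ge0// ltW// Gamma_gt0.
pose v t : \bar R := (t `^ (b - a - 1) * expR (- t))%:E.
have mv : ge0_measurable v.
  split; last by move=> t; rewrite lee_fin mulr_ge0 ?powR_ge0 ?expR_ge0.
  apply/measurable_EFinP; apply: measurable_funM; first exact: measurable_powR.
  exact: measurable_expRN.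
pose u t : \bar R := k%:E * v t.
transitivity (haar (fun t => if (x < t)%R then t%:E * u (t - x)%R else 0)).
  apply: eq_haar => t t0; rewrite exp_kernelE// -EFinM mulrAC beta_kernel_shift//.
  case: ifPn => xt; last by rewrite mul0r.
  rewrite /u /v -!EFinM; congr EFin; rewrite /k opprB.
  have -> : (expR (- t) = expR (- x) * expR (x - t))%R.
    by rewrite -expRD; congr expR; ring.
  by ring.
rewrite haar_shift ?ltW//; last first.
  split; last by move=> t; rewrite mule_ge0// mv.2.
  by apply: measurable_funeM; exact: mv.1.
transitivity (haar (fun t => k%:E * exp_kernel (b - a) t)).
  apply: eq_haar => t t0; rewrite exp_kernelE// /u /v muleCA; congr (_ * _).
  by rewrite -EFinM mulrA mulr_powRB1// ltW.
rewrite haarZl ?lee_fin//; last exact: ge0_measurable_exp_kernel.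
rewrite -GammaE// -EFinM exp_kernelE//; congr EFin; rewrite /k.
by rewrite mulrAC divfK// gt_eqF// Gamma_gt0.
Qed.

(** After translation this is the integral of t^(b-a-1) over (0, 1 - x), that is (1 - x)^(b-a) / (b
    - a); the denominator is absorbed by the functional equation of Gamma. *)
Lemma econv_pow_kernel_beta a b : (a < b)%R ->
  econv (pow_kernel b) (fun x => (beta_kernel a b x)%:E) =
  (fun x => (beta_kernel a (b + 1) x)%:E).
Proof.
move=> ab; apply/funext => x; rewrite /econv; case: ifPn => x0; last first.
  by rewrite /beta_kernel (negbTE x0).
have ba0 : (0 < b - a)%R by rewrite subr_gt0.
have G0 := Gamma_gt0 ba0.
pose k := (x `^ a / Gamma (b - a))%R.
have k0 : (0 <= k)%R by rewrite divr_ge0 ?powR_ge0// ltW.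
(* The translated form of the cutoff t < 1 of [pow_kernel]. *)
pose v t : \bar R := if (t < 1 - x)%R then (t `^ (b - a - 1))%:E else 0.
have mv : ge0_measurable v.
  apply: ge0_measurable_if; first exact: measurable_ltr.
    exact: measurable_powR.
  by move=> t _; exact: powR_ge0.
pose u t : \bar R := k%:E * v t.
transitivity (haar (fun t => if (x < t)%R then t%:E * u (t - x)%R else 0)).
  apply: eq_haar => t t0; rewrite /pow_kernel t0/= /u /v.
  case: ifPn => t1; last first.
    rewrite mul0e ltrD2r (negbTE t1) !mule0.
    by case: ifP.
  rewrite ltrD2r t1 -EFinM beta_kernel_shift//.
  by case: ifPn => xt//; rewrite -!EFinM.
rewrite haar_shift ?ltW//; last first.
  split; last by move=> t; rewrite mule_ge0// mv.2.
  by apply: measurable_funeM; exact: mv.1.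
rewrite /beta_kernel x0/=; case: ifPn => x1; last first.
  transitivity (haar (fun t : R => 0 * (rinv t)%:E)); last first.
    by rewrite haarZl ?mul0e//; exact: ge0_measurable_rinv.
  apply: eq_haar => t t0; rewrite /u /v mul0e; case: ifPn => t1; rewrite ?mule0//.
  exfalso; move: x1 t0 t1; rewrite -leNgt; lra.
have y0 : (0 < 1 - x)%R by rewrite subr_gt0.
transitivity (haar (fun t => (k * (1 - x) `^ (b - a))%:E *
    pow_kernel (b - a) ((1 - x)^-1 * t)%R)).
  apply: eq_haar => t t0; rewrite /u /v /pow_kernel.
  rewrite mulr_gt0 ?invr_gt0//= (mulrC (1 - x)^-1%R t) ltr_pdivrMr// mul1r.
  case: ifPn => t1; last by rewrite !mule0.
  rewrite -!EFinM; congr EFin.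
  rewrite mulrCA mulr_powRB1 ?(ltW t0)// -[RHS]mulrA -powRM ?divr_ge0 ?(ltW y0) ?(ltW t0)//.
  by rewrite mulrCA divff ?mulr1// gt_eqF.
have mp := ge0_measurable_pow_kernel (b - a).
have mps := ge0_measurable_comp mp (mulrl_measurable (1 - x)^-1%R).
have ky0 : 0 <= (k * (1 - x) `^ (b - a))%:E.
  by rewrite lee_fin (mulr_ge0 k0)// powR_ge0.
rewrite (haarZl mps ky0).
rewrite haar_scale ?invr_gt0// haar_pow_kernel// -EFinM; congr EFin.
have -> : (b + 1 - a = b - a + 1)%R by ring.
by rewrite GammaS// addrK /k; field; rewrite !gt_eqF.
Qed.

(** The Mellin transform of [econv_exp_kernel_beta] reads Gamma(s + b) M = Gamma(s + a). As Gamma(s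
    + b) > 0 and the right side is finite, M is finite and one may divide. *)
Lemma haar_pweight_beta a b s : (a < b)%R -> (0 < s + a)%R ->
  haar (pweight s (fun x => (beta_kernel a b x)%:E)) =
  (Gamma (s + a) / Gamma (s + b))%:E.
Proof.
move=> ab sa0; have sb0 : (0 < s + b)%R by rewrite (lt_trans sa0)// ltrD2l.
have mb := ge0_measurable_beta_kernel ab.
have /eqP := haar_pweight_econv s (ge0_measurable_exp_kernel b) mb.
rewrite econv_exp_kernel_beta// !pweight_exp_kernel -!GammaE//.
have := haar_ge0 (ge0_measurable_pweight s mb).2.
case: (haar _) => [r _||//].
  rewrite -EFinM eqe => /eqP ->; congr EFin.
  by rewrite mulrAC divff ?mul1r// gt_eqF// Gamma_gt0.
by rewrite gt0_muley// lte_fin Gamma_gt0.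
Qed.

End gamma.

(** * Iterated convolution of beta kernels *)

Definition incr (R : realType) q (c : 'I_q -> R) (j : 'I_q) : 'I_q -> R :=
  fun k => c k + (k == j)%:R.

Section ew0.
Local Open Scope ereal_scope.
Context {R : realType}.
Local Notation mu := (@lebesgue_measure R).

Lemma haar_lty_ae (F : R -> \bar R) s : ge0_measurable F ->
  haar (pweight s F) < +oo ->
  {ae mu, forall t, (0 < t)%R -> F t \is a fin_num}.
Proof.
move=> mF Foo; have mpF := ge0_measurable_pweight s mF.
have [mG G0] := ge0_measurableM mpF ge0_measurable_rinv.
have : mu.-integrable setT (fun t => pweight s F t * (rinv t)%:E).
  apply/integrableP; split => //.
  by under eq_integral do rewrite gee0_abs//.
move/integrable_ae => /(_ measurableT); apply: filterS => t /(_ I).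
move=> /[swap] t0; rewrite /pweight; have := mF.2 t.
case: (F t) => [r _ _||]//.
rewrite gt0_muley ?lte_fin ?powR_gt0// gt0_mulye// lte_fin rinv_gt0//.
Qed.

(** Real-valued convolution sees only finite parts. A finite Mellin transform makes F finite almost
    everywhere, so nothing is lost under the integral. *)
Lemma haar_fine (F G : R -> \bar R) s : ge0_measurable F -> ge0_measurable G ->
  haar (pweight s F) < +oo ->
  haar (fun t => (fine (F t))%:E * G t) = haar (fun t => F t * G t).
Proof.
move=> mF mG Foo.
have mFr : ge0_measurable (fun t => (fine (F t))%:E).
  split; last by move=> t; rewrite lee_fin fine_ge0// mF.2.
  by apply/measurable_EFinP; apply: measurableT_comp => //; exact: mF.1.
have m1 := ge0_measurableM (ge0_measurableM mFr mG) ge0_measurable_rinv.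
have m2 := ge0_measurableM (ge0_measurableM mF mG) ge0_measurable_rinv.
apply: ge0_ae_eq_integral => //.
- exact: m1.1.
- exact: m2.1.
- by move=> t _; exact: m1.2.
- by move=> t _; exact: m2.2.
have := haar_lty_ae mF Foo; apply: filterS.
  exact: (ae_filter_ringOfSetsType mu).
move=> t Ft _.
have [t0|t0] := ltP 0%R t; last by rewrite rinv_le0// !mule0.
by rewrite fineK// Ft.
Qed.

(** The equality holds at every x > 0: where the integral is infinite, both sides have the default
    value 0. *)
Lemma mconvE (f : R -> R) (g : R -> R) (F : R -> \bar R) s x :
  ge0_measurable F -> (forall t, (0 < t)%R -> f t = fine (F t)) ->
  haar (pweight s F) < +oo -> ge0_measurable (EFin \o g) -> (0 < x)%R ->
  mconv f g x = fine (econv F (EFin \o g) x).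
Proof.
move=> mF fF Foo mg x0; congr fine; rewrite econvE//.
have mgx : ge0_measurable (fun t => (g (x * rinv t)%R)%:E).
  apply: (ge0_measurable_comp mg); apply: measurable_funM => //.
  exact: measurable_rinv.
rewrite integral_itv0y -(haar_fine mF mgx Foo).
apply: eq_haar => t t0; rewrite fF// rinvE// -!EFinM; congr EFin.
by rewrite mulrCA divff ?mulr1// gt_eqF.
Qed.

Context (q : nat) (a : 'I_q -> R).
Implicit Types (c : 'I_q -> R) (j : 'I_q) (s : seq 'I_q) (F : R -> \bar R).

Let ebeta c j : R -> \bar R := fun x => (beta_kernel (a j) (c j) x)%:E.

Definition econv_seq c F s : R -> \bar R :=
  foldl (fun G j => econv G (ebeta c j)) F s.

(** The version of [w0] with values in [0, +oo], for which the algebra of convolution holds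
    pointwise. *)
Definition ew0 c : R -> \bar R :=
  if enum 'I_q is j :: s then econv_seq c (ebeta c j) s else cst 0.

Definition ew0_admissible c := forall j, (a j < c j)%R.

Lemma ew0_admissible_incr c j : ew0_admissible c -> ew0_admissible (incr c j).
Proof. by move=> ac k; rewrite (lt_le_trans (ac k))// lerDl. Qed.

Lemma ge0_measurable_econv_seq c F s : ew0_admissible c -> ge0_measurable F ->
  ge0_measurable (econv_seq c F s).
Proof.
move=> ac; elim: s F => [//|j s ih] F mF /=; apply: ih.
by apply: ge0_measurable_econv => //; exact: ge0_measurable_beta_kernel.
Qed.

Lemma ge0_measurable_ew0 c : ew0_admissible c -> ge0_measurable (ew0 c).
Proof.
move=> ac; rewrite /ew0; case: (enum _) => [|j s].
  by split => [|x]; [exact: measurable_cst|exact: lexx].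
by apply: ge0_measurable_econv_seq => //; exact: ge0_measurable_beta_kernel.
Qed.

Lemma haar_pweight_econv_seq c F s y : ew0_admissible c -> ge0_measurable F ->
  (forall j, (0 < y + a j)%R) ->
  haar (pweight y (econv_seq c F s)) =
  haar (pweight y F) * (\prod_(j <- s) (Gamma (y + a j) / Gamma (y + c j)))%:E.
Proof.
move=> ac mF ya; elim: s F mF => [|j s ih] F mF/=.
  by rewrite big_nil mule1.
have mb := ge0_measurable_beta_kernel (ac j).
rewrite ih; last exact: ge0_measurable_econv.
by rewrite haar_pweight_econv// haar_pweight_beta// big_cons [in RHS]EFinM muleA.
Qed.

Lemma haar_pweight_ew0 c y : (0 < q)%N -> ew0_admissible c ->
  (forall j, (0 < y + a j)%R) ->
  haar (pweight y (ew0 c)) =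
  (\prod_(j < q) (Gamma (y + a j) / Gamma (y + c j)))%:E.
Proof.
move=> q0 ac ya; rewrite /ew0 -[in RHS]big_enum/=.
case: (enum _) (size_enum_ord q) => [s0|j s _].
  by have := q0; rewrite -[X in (_ < X)%N]s0.
rewrite haar_pweight_econv_seq//; last exact: ge0_measurable_beta_kernel.
by rewrite haar_pweight_beta// big_cons [in RHS]EFinM.
Qed.

(** The exponent y only serves to carry a finite Mellin transform, hence finiteness almost
    everywhere, through each convolution. *)
Lemma mconv_seqE c f F s y x : ew0_admissible c -> ge0_measurable F ->
  (forall j, (0 < y + a j)%R) -> haar (pweight y F) < +oo ->
  (forall t, (0 < t)%R -> f t = fine (F t)) -> (0 < x)%R ->
  foldl (@mconv R) f [seq beta_kernel (a j) (c j) | j <- s] x =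
  fine (econv_seq c F s x).
Proof.
move=> ac mF ya + + x0; elim: s f F mF => [|j s ih] f F mF Foo fF/=; first exact: fF.
have mb := ge0_measurable_beta_kernel (ac j).
apply: ih; first exact: ge0_measurable_econv.
  rewrite haar_pweight_econv// haar_pweight_beta//.
  have := haar_ge0 (ge0_measurable_pweight y mF).2.
  by move: Foo; case: (haar _) => [r _ _||]//; rewrite -EFinM ltry.
by move=> t t0; exact: (mconvE mF fF Foo).
Qed.

Lemma w0E c x : (forall j, (-1 < a j)%R) -> ew0_admissible c -> (0 < x)%R ->
  w0 a c x = fine (ew0 c x).
Proof.
move=> a1 ac x0; rewrite /w0 /ew0; case: (enum _) => [//|j s] /=.
have a1' k : (0 < 1 + a k)%R by rewrite -ltrBlDl sub0r.
(* The exponent 1 is admissible because every a_j exceeds -1. *)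
apply: (@mconv_seqE c _ (ebeta c j) s 1%R) => //.
  exact: ge0_measurable_beta_kernel.
by rewrite haar_pweight_beta// ltry.
Qed.

(** If t < 1 <= x then x/t >= 1, so one of the two factors always vanishes. *)
Lemma econv_ge1 (F G : R -> \bar R) x : (forall t, (1 <= t)%R -> F t = 0) ->
  (forall t, (1 <= t)%R -> G t = 0) -> (1 <= x)%R -> econv F G x = 0.
Proof.
move=> F0 G0 x1; have x0 := lt_le_trans ltr01 x1; rewrite econvE//.
transitivity (haar (fun t : R => 0 * (rinv t)%:E)); last first.
  by rewrite haarZl ?mul0e//; exact: ge0_measurable_rinv.
apply: eq_haar => t t0; rewrite mul0e.
have [t1|/ltW t1] := leP 1%R t; first by rewrite F0// mul0e.
by rewrite G0 ?mule0// rinvE// ler_pdivlMr// mul1r (le_trans t1).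
Qed.

Lemma ew0_ge1 c x : (1 <= x)%R -> ew0 c x = 0.
Proof.
have b1 j t : (1 <= t)%R -> ebeta c j t = 0.
  by move=> t1; rewrite /ebeta/= /beta_kernel ltNge (ltNge t) t1/= andbF.
rewrite /ew0; case: (enum _) => [//|j s].
move: x; elim: s (ebeta c j) (b1 j) => [|k s ih] F F0 x x1 /=; first exact: F0.
by apply: ih => // t t1; apply: econv_ge1 => // u; exact: b1.
Qed.

Lemma econv_seq_eq c c' F s : {in s, forall j, c j = c' j} ->
  econv_seq c F s = econv_seq c' F s.
Proof.
elim: s F => [F _|j s ih F cc' /=]; first by [].
have -> : ebeta c j = ebeta c' j by rewrite /ebeta cc' ?mem_head.
by apply: ih => k ks; apply: cc'; rewrite in_cons ks orbT.
Qed.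

Lemma econv_seq_econv c F s b : ew0_admissible c -> ge0_measurable F ->
  econv_seq c (econv F (pow_kernel b)) s = econv (econv_seq c F s) (pow_kernel b).
Proof.
move=> ac; elim: s F => [//|j s ih] F mF /=.
have mk := ge0_measurable_pow_kernel b.
have mb := ge0_measurable_beta_kernel (ac j).
rewrite -ih; last exact: ge0_measurable_econv.
by rewrite econvA// (econvC mk mb) -econvA.
Qed.

(** Only the factor of index j changes; the power kernel that it acquires is moved outwards past the
    other factors. *)
Lemma ew0_incr c j : ew0_admissible c ->
  ew0 (incr c j) = econv (ew0 c) (pow_kernel (c j)).
Proof.
move=> ac; rewrite /ew0.
have : j \in enum 'I_q by rewrite mem_enum.
have := enum_uniq 'I_q.
have mb k : ge0_measurable (ebeta c k) := ge0_measurable_beta_kernel (ac k).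
have mk := ge0_measurable_pow_kernel (c j).
have bj : ebeta (incr c j) j = econv (ebeta c j) (pow_kernel (c j)).
  rewrite (econvC (mb j) mk) [RHS](econv_pow_kernel_beta (ac j)).
  by rewrite /ebeta /incr eqxx.
have bneq k : k != j -> ebeta (incr c j) k = ebeta c k.
  by move=> kj; rewrite /ebeta /incr (negbTE kj) addr0.
have sneq s F : j \notin s -> econv_seq (incr c j) F s = econv_seq c F s.
  move=> js; apply: econv_seq_eq => k ks; rewrite /incr.
  by case: eqVneq ks js => [->->//|_ _ _]; rewrite addr0.
(* The head of the enumeration seeds the fold, hence a separate case. Absence of repetitions ensures
   that j occurs exactly once. *)
case: (enum _) => [//|k s] /= /andP[ks us]; rewrite in_cons => /predU1P[kj|].
  by rewrite -kj in ks *; rewrite sneq// bj (econv_seq_econv _ _ ac (mb j)).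
move=> js; rewrite bneq; last by apply: contraNneq ks => ->.
elim: s (ebeta c k) (mb k) js us {ks} => [//|l s ih] F mF /=.
rewrite in_cons => /predU1P[jl|js] /andP[ls us].
  rewrite -jl in ls *; rewrite sneq// bj -(econvA mF (mb j) mk).
  exact: (econv_seq_econv _ _ ac (ge0_measurable_econv mF (mb j))).
rewrite bneq; last by apply: contraNneq ls => ->.
by apply: ih => //; exact: ge0_measurable_econv.
Qed.

End ew0.

(** * Moments and regularity of the weights *)

(** The Mellin transform of [w0 a c] at y. *)
Definition gamma_ratio (R : realType) q (a c : 'I_q -> R) (y : R) : R :=
  \prod_(j < q) (Gamma (y + a j) / Gamma (y + c j)).

Section w0_regularity.
Context {R : realType} (q : nat) (a : 'I_q -> R).
Hypotheses (q0 : (0 < q)%N) (a1 : forall j, -1 < a j).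
Local Notation mu := (@lebesgue_measure R).
Implicit Types (c : 'I_q -> R) (j : 'I_q) (x y t : R).

Let a1n j k : 0 < k.+1%:R + a j.
Proof. by have := a1 j; have : 0 <= k%:R :> R by []; rewrite -natr1; lra. Qed.

Let ew0_lty c : ew0_admissible a c -> (haar (pweight 1%:R (ew0 a c)) < +oo)%E.
Proof. by move=> ac; rewrite haar_pweight_ew0 ?ltry// => j; exact: a1n. Qed.

Lemma w0_ge0 c x : ew0_admissible a c -> 0 < x -> 0 <= w0 a c x.
Proof. by move=> ac x0; rewrite w0E// fine_ge0// (ge0_measurable_ew0 ac).2. Qed.

Lemma w0_ge1 c x : ew0_admissible a c -> 1 <= x -> w0 a c x = 0.
Proof. by move=> ac x1; rewrite w0E ?ew0_ge1// (lt_le_trans _ x1). Qed.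

Lemma measurable_w0 c : ew0_admissible a c -> measurable_fun (`]0, +oo[ : set R) (w0 a c).
Proof.
move=> ac; apply: (@eq_measurable_fun _ _ _ _ _ (fun x => fine (ew0 a c x))).
  by move=> x; rewrite inE/= in_itv/= andbT => x0; rewrite w0E.
apply: measurable_funTS; apply: measurableT_comp => //.
exact: (ge0_measurable_ew0 ac).1.
Qed.

Lemma integral_w0 c k : ew0_admissible a c ->
  (\int[mu]_(t in `]0%R, +oo[) (t ^+ k * w0 a c t)%:E =
   (gamma_ratio a c k.+1%:R)%:E)%E.
Proof.
move=> ac; have mW := ge0_measurable_ew0 ac.
rewrite -haar_pweight_ew0// integral_itv0y.
have mp : ge0_measurable (fun t => (t `^ k.+1%:R)%:E).
  split; last by move=> t; rewrite lee_fin powR_ge0.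
  by apply/measurable_EFinP; exact: measurable_powR.
transitivity (haar (fun t => (fine (ew0 a c t))%:E * (t `^ k.+1%:R)%:E)%E).
  apply: eq_haar => t t0; rewrite w0E// -!EFinM powR_mulrn ?ltW// exprS.
  by congr EFin; ring.
rewrite (haar_fine mW mp (ew0_lty ac)).
by apply: eq_haar => t t0; rewrite muleC.
Qed.

Lemma integrable_w0 c k : ew0_admissible a c ->
  mu.-integrable `]0, +oo[ (fun t => (t ^+ k * w0 a c t)%:E).
Proof.
move=> ac; apply/integrableP; split.
  apply/measurable_EFinP/measurable_funM; last exact: measurable_w0.
  by apply: measurable_funTS; exact: exprn_measurable.
rewrite (_ : integral _ _ _ = (gamma_ratio a c k.+1%:R)%:E) ?ltry//.
rewrite -integral_w0//; apply: eq_integral => t.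
rewrite inE/= in_itv/= andbT => t0.
by rewrite ger0_norm// mulr_ge0 ?w0_ge0// exprn_ge0// ltW.
Qed.

Let phi c j t := t `^ (- c j - 1) * w0 a c t.

Let integrable_phi c j x : ew0_admissible a c -> 0 < x ->
  mu.-integrable `[x, 1] (EFin \o phi c j).
Proof.
move=> ac x0.
have sub : `[x, 1] `<=` (`]0, +oo[ : set R).
  by move=> t/=; rewrite !in_itv/= => /andP[/(lt_le_trans x0) -> _].
have c2 : 0 <= c j + 2 by have := a1 j; have := ac j; lra.
(* For t >= x, t^(-c_j-1) = t^(-(c_j+2)) t <= x^(-(c_j+2)) t because c_j + 2 >= 0; the integrable
   first moment of [w0] thus dominates. *)
pose g t := ((x `^ (- (c j + 2)))%:E * (t ^+ 1 * w0 a c t)%:E)%E.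
have mx : measurable (`[x, 1]%classic : set (measurableTypeR R)).
  exact: measurable_itv.
apply: (@le_integrable _ _ _ mu _ mx _ g).
- apply/measurable_EFinP/measurable_funM.
    by apply: measurable_funTS; exact: measurable_powR.
  by apply: (measurable_funS _ sub) => //; exact: measurable_w0.
- move=> t xt; have t0 : 0 < t by have := sub _ xt; rewrite /= in_itv/= andbT.
  have {}xt : x <= t by move: xt; rewrite /= in_itv/= => /andP[].
  have -> : g t = (x `^ (- (c j + 2)) * (t * w0 a c t))%:E by rewrite /g expr1 EFinM.
  rewrite !abse_EFin lee_fin /phi mulrA !normrM.
  apply: ler_wpM2r => //; rewrite !ger0_norm ?powR_ge0 ?(ltW t0)//.
  have -> : - c j - 1 = - (c j + 2) + 1 by ring.
  rewrite powRD; last by rewrite (gt_eqF t0) implybT.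
  rewrite powRr1 ?(ltW t0)//; apply: ler_wpM2r; first exact: ltW.
  rewrite !powRN lef_pV2 ?posrE ?powR_gt0//.
  by apply: ge0_ler_powR; rewrite ?nnegrE// ltW.
- apply: integrableZl => //; apply: (integrableS _ mx sub (integrable_w0 1 ac)).
  exact: measurable_itv.
Qed.

Lemma w0_incrE c j x : ew0_admissible a c -> 0 < x -> x < 1 ->
  w0 a (incr c j) x = x `^ (c j) * \int[mu]_(t in `[x, 1]) phi c j t.
Proof.
move=> ac x0 x1; have ai := ew0_admissible_incr j ac.
have mk : ge0_measurable (fun t => pow_kernel (c j) (x * rinv t)).
  apply: (ge0_measurable_comp (ge0_measurable_pow_kernel _)).
  by apply: measurable_funM => //; exact: measurable_rinv.
rewrite w0E// ew0_incr// econvE// -(haar_fine (ge0_measurable_ew0 ac) mk (ew0_lty ac)).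
have intphi := integrable_phi j ac x0.
have intphi' : mu.-integrable `]x, 1] (EFin \o phi c j).
  by apply: integrableS intphi => //; exact: subset_itv_oc_cc.
rewrite -Rintegral_itv_obnd_cbnd//.
have -> : haar (fun t => (fine (ew0 a c t))%:E * pow_kernel (c j) (x * rinv t))%E =
    ((x `^ (c j))%:E * \int[mu]_(t in `]x, 1%R]) (phi c j t)%:E)%E.
  rewrite -integralZl// integral_mkcond; apply: eq_integral => t _.
  rewrite patchE; have [t0|t0] := ltP 0 t; last first.
    rewrite rinv_le0// mule0 memNset//= in_itv/=; apply/negP.
    by rewrite negb_and -leNgt (le_trans t0 (ltW x0)).
  rewrite /pow_kernel mulr_gt0 ?rinv_gt0//= rinvE// ltr_pdivrMr// mul1r.
  rewrite -w0E//; case: ifPn => xt; last first.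
    by rewrite mule0 mul0e memNset//= in_itv/= (negbTE xt).
  have [t1|/ltW t1] := leP t 1; last first.
    by rewrite w0_ge1// !mul0e; case: ifP => // _; rewrite /phi w0_ge1// mulr0 mule0.
  rewrite mem_set//= ?in_itv/= ?xt// -!EFinM; congr EFin.
  rewrite /phi !powR_expR ?divr_gt0// ln_div ?posrE//.
  rewrite -[X in _ / X = _](lnK (t0 : t \is Num.pos)) -expRN.
  transitivity (w0 a c t * (expR (c j * (ln x - ln t)) * expR (- ln t))); first by ring.
  transitivity (w0 a c t * (expR (c j * ln x) * expR ((- c j - 1) * ln t))); last by ring.
  by congr (_ * _); rewrite -!expRD; congr expR; ring.
rewrite fineM//; exact: integrable_fin_num.
Qed.

(** A fixed lower endpoint d puts the dependence of the integral on x into one over [d, x], the form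
    suited to the fundamental theorem of calculus. *)
Lemma w0_incr_itv c j d x : ew0_admissible a c -> 0 < d -> d < x -> x < 1 ->
  w0 a (incr c j) x = x `^ (c j) *
    (\int[mu]_(t in `[d, 1]) phi c j t - parameterized_integral mu d x (phi c j)).
Proof.
move=> ac d0 dx x1; have x0 := lt_trans d0 dx.
rewrite w0_incrE//; congr (_ * _); rewrite /parameterized_integral.
have intphi := integrable_phi j ac x0.
rewrite Rintegral_itvB ?bnd_simp ?(ltW dx) ?(ltW x1)//; last exact: integrable_phi.
rewrite Rintegral_itv_obnd_cbnd//.
by apply: integrableS intphi => //; exact: subset_itv_oc_cc.
Qed.

Let near_itv x : 0 < x -> x < 1 -> \forall y \near x, x / 2 < y < 1.
Proof.
move=> x0 x1.
have : x \in `](x / 2), 1[ by rewrite in_itv/= x1 andbT ltr_pdivrMr// ltr_pMr// ltr1n.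
move=> xI; have := near_in_itvoo xI; apply: filterS => y.
by rewrite in_itv.
Qed.

Let continuous_powR x b : 0 < x -> {for x, continuous (fun t => t `^ b)}.
Proof.
move=> x0; apply: differentiable_continuous; apply/derivable1_diffP.
by apply: derivable_powR; rewrite in_itv/= x0.
Qed.

(** The integral of an integrable function is continuous in its endpoint, so one convolution with a
    power kernel creates continuity. *)
Lemma continuous_w0_incr c j x : ew0_admissible a c -> 0 < x -> x < 1 ->
  {for x, continuous (w0 a (incr c j))}.
Proof.
move=> ac x0 x1; have d0 : 0 < x / 2 by rewrite divr_gt0.
have xd : x / 2 < x by rewrite ltr_pdivrMr// ltr_pMr// ltr1n.
have d1 := ltW (lt_trans xd x1).
have near_eq : \forall y \near x, y `^ (c j) *
    (\int[mu]_(t in `[(x / 2), 1]) phi c j t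
     - parameterized_integral mu (x / 2) y (phi c j)) = w0 a (incr c j) y.
  apply: filterS (near_itv x0 x1) => y /andP[y0 y1].
  by rewrite -w0_incr_itv.
rewrite /prop_for /continuous_at.
rewrite -(nbhs_singleton near_eq); apply: cvg_trans (near_eq_cvg near_eq) _.
apply: cvgM; first exact: continuous_powR.
apply: cvgB; first exact: cvg_cst.
have := parameterized_integral_continuous d1 (integrable_phi j ac d0).
by move=> /continuous_within_itvP - /(_ (lt_trans xd x1))[+ _ _]; apply; rewrite in_itv/= xd.
Qed.

(** The fundamental theorem of calculus needs the integrand continuous at x; differentiability
    therefore sits one level above continuity. *)
Lemma is_derive_w0_incr c j x : ew0_admissible a c -> 0 < x -> x < 1 ->
  {for x, continuous (w0 a c)} ->
  is_derive x 1 (w0 a (incr c j))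
    ((c j * w0 a (incr c j) x - w0 a c x) / x).
Proof.
move=> ac x0 x1 cw; have d0 : 0 < x / 2 by rewrite divr_gt0.
have xd : x / 2 < x by rewrite ltr_pdivrMr// ltr_pMr// ltr1n.
pose P y := parameterized_integral mu (x / 2) y (phi c j).
pose C := \int[mu]_(t in `[(x / 2), 1]) phi c j t.
have cphi : {for x, continuous (phi c j)}.
  by apply: cvgM => //; exact: continuous_powR.
have [dP P'] := continuous_FTC1_closed x1 (integrable_phi j ac d0) xd cphi.
have dP' : is_derive x 1 P (phi c j x).
  by rewrite -P' derive1E; exact: derivableP.
have x0' : x \in `]0, +oo[%R by rewrite in_itv/= x0.
have dpow : is_derive x 1 (fun y => y `^ c j) (c j * x `^ (c j - 1)).
  by rewrite -powR_derive1// derive1E; exact/derivableP/derivable_powR.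
have dC : is_derive x 1 (cst C - P) (0 - phi c j x) by exact: is_deriveB.
have dM := is_deriveM dpow dC.
have near_eq : \near x, ((fun y => y `^ c j) * (cst C - P)) x = w0 a (incr c j) x.
  apply: filterS (near_itv x0 x1) => y /andP[y0 y1].
  by rewrite /= (w0_incr_itv j ac d0).
have D := near_eq_is_derive near_eq dM.
rewrite [X in is_derive _ _ _ X](_ : _ = x `^ c j *: (0 - phi c j x)
  + (cst C - P) x *: (c j * x `^ (c j - 1))); first exact: D.
rewrite -(nbhs_singleton near_eq) /GRing.scale/= /cst /phi.
rewrite powRB ?(gt_eqF x0) ?implybT// powRB ?(gt_eqF x0) ?implybT//.
rewrite powRr1 ?(ltW x0)// powRN.
rewrite mulrfctE /=; field.
by rewrite !gt_eqF ?powR_gt0.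
Qed.

End w0_regularity.

(** * Rodrigues operators on combinations of weights *)

Lemma gamma_ratio_incr (R : realType) q (a c : 'I_q -> R) (j : 'I_q) (y : R) :
  0 < y + c j ->
  gamma_ratio a (incr c j) y * (y + c j) = gamma_ratio a c y.
Proof.
move=> yc; rewrite /gamma_ratio (bigD1 j)//= [in RHS](bigD1 j)//=.
rewrite (eq_bigr (fun k => Gamma (y + a k) / Gamma (y + c k))); last first.
  by move=> k kj; rewrite /incr (negbTE kj) addr0.
rewrite /incr eqxx addrA GammaS//; set P := \prod_(_ < _ | _) _.
by field; rewrite !gt_eqF// Gamma_gt0.
Qed.

Section w0_span.
Context {R : realType} (q : nat) (a b : 'I_q -> R).
Hypotheses (q0 : (0 < q)%N) (a1 : forall j, -1 < a j) (ab : forall j, a j < b j).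
Implicit Types (nu : 'I_q -> nat) (L : seq (R * ('I_q -> nat))) (x y d : R).

Definition shift_param nu : 'I_q -> R := fun k => b k + (nu k)%:R.

(** The list is a formal linear combination, read here as a function and next as its Mellin
    transform, so that one rewriting of the list acts on both. *)
Definition w0_comb L x : R := \sum_(p <- L) p.1 * w0 a (shift_param p.2) x.

Definition moment_comb L y : R :=
  \sum_(p <- L) p.1 * gamma_ratio a (shift_param p.2) y.

(* Each derivative lowers the level [k] by one; level 1 ensures continuity on
   (0, 1). *)
Definition comb_level k L := all (fun p => (k <= \sum_j p.2 j)%N) L.

Lemma shift_param_admissible nu : ew0_admissible a (shift_param nu).
Proof. by move=> j; rewrite (lt_le_trans (ab j))// lerDl. Qed.

Lemma shift_param_pred k nu : (k < \sum_j nu j)%N ->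
  exists j, exists nu', (k <= \sum_j nu' j)%N /\
    shift_param nu = incr (shift_param nu') j.
Proof.
move=> knu; have /existsP[j j0] : [exists j, (0 < nu j)%N].
  rewrite -[X in is_true X]negbK negb_exists; apply/negP => /forallP n0.
  suff s0 : (\sum_j nu j = 0)%N by rewrite s0 in knu.
  by apply: big1 => j _; have := n0 j; rewrite lt0n negbK => /eqP.
exists j, (fun k => nu k - (k == j))%N; split.
  move: knu; rewrite (bigD1 j)// [in X in _ -> X](bigD1 j)//= eqxx subn1.
  rewrite [X in _ -> (_ <= _ + X)%N](eq_bigr nu); last first.
    by move=> i /negbTE ->; rewrite subn0.
  by case: (nu j) j0 => // n _; rewrite addSn ltnS.
apply/funext => k'; rewrite /shift_param /incr -addrA; congr (_ + _).
case: eqVneq => [->|_]; last by rewrite addr0 subn0.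
by rewrite -natrD subnK.
Qed.

Lemma continuous_w0_shift nu x : (0 < \sum_j nu j)%N -> 0 < x -> x < 1 ->
  {for x, continuous (w0 a (shift_param nu))}.
Proof.
move=> /shift_param_pred[j [nu' [_ ->]]] x0 x1.
by apply: continuous_w0_incr => //; exact: shift_param_admissible.
Qed.

Lemma continuous_w0_comb L x : comb_level 1 L -> 0 < x -> x < 1 ->
  {for x, continuous (w0_comb L)}.
Proof.
move=> + x0 x1; rewrite /w0_comb; elim: L => [_|p L ih /andP[p1 L1]].
  rewrite (_ : (fun _ => _) = cst 0); first exact: cst_continuous.
  by apply/funext => y; rewrite big_nil.
rewrite (_ : (fun _ => _) = (fun y => p.1 * w0 a (shift_param p.2) y
  + \sum_(p <- L) p.1 * w0 a (shift_param p.2) y)); last first.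
  by apply/funext => y; rewrite big_cons.
apply: cvgD; last exact: ih.
by apply: cvgM; [exact: cvg_cst|exact: continuous_w0_shift].
Qed.

(** [L'] stands for x f' + d f, where f is the function of [L]. The factor d - y is the one that
    integration by parts would give; it is obtained from the recurrence of [gamma_ratio], so no
    boundary terms arise. *)
Lemma euler_comb k L d : comb_level k.+2 L -> exists L', [/\ comb_level k.+1 L',
  forall x, 0 < x -> x < 1 ->
    is_derive x 1 (w0_comb L) ((w0_comb L' x - d * w0_comb L x) / x) &
  forall y, (forall j, 0 < y + a j) ->
    moment_comb L' y = (d - y) * moment_comb L y].
Proof.
elim: L => [_|[r nu] L ih /andP[/=nuk Lk]].
  exists [::]; split => // [x x0 x1|y _]; last by rewrite /moment_comb !big_nil mulr0.
  rewrite /w0_comb !big_nil mulr0 subr0 mul0r.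
  rewrite (_ : (fun _ => _) = cst 0); first exact: is_derive_cst.
  by apply/funext => y; rewrite big_nil.
have [L' [L'k dL' mL']] := ih Lk.
have [j [nu' [nu'k nuE]]] := shift_param_pred nuk.
set c := shift_param nu' in nuE.
have ac : ew0_admissible a c by exact: shift_param_admissible.
(* For w = [w0 a (incr c j)], x w' + d w = (d + c_j) w - [w0 a c]; on the transforms, d + c_j - (y +
   c_j) = d - y. *)
exists [:: (r * (d + c j), nu), (- r, nu') & L']; split.
- by apply/and3P; split => //; exact: ltnW.
- move=> x x0 x1.
  rewrite [X in is_derive _ _ X _](_ : _ = (fun y => r * w0 a (shift_param nu) y)
    + w0_comb L); last first.
    by apply/funext => y; rewrite /w0_comb big_cons.
  have cc : {for x, continuous (w0 a c)}.
    by apply: continuous_w0_shift => //; exact: leq_ltn_trans nu'k.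
  have D1 := is_deriveZ r (is_derive_w0_incr q0 a1 j ac x0 x1 cc).
  have D := is_deriveD D1 (dL' x x0 x1).
  rewrite nuE [X in is_derive _ _ _ X](_ : _ =
   r *: ((c j * w0 a (incr c j) x - w0 a c x) / x) +
   (w0_comb L' x - d * w0_comb L x) / x); first exact: D.
  rewrite /w0_comb !big_cons/= nuE -/c /GRing.scale/=.
  set s1 := \sum_(_ <- _) _; set s2 := \sum_(_ <- _) _.
  ring.
- move=> y ya; rewrite /moment_comb !big_cons/= -/(moment_comb L' y) -/(moment_comb L y).
  rewrite mL'// nuE -/c -(@gamma_ratio_incr _ _ a c j); first by ring.
  by rewrite (lt_trans (ya j))// ltrD2l.
Qed.


Let near_itv01 x : 0 < x -> x < 1 -> \forall y \near x, 0 < y < 1.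
Proof.
move=> x0 x1.
have xI : x \in `]0, 1[ by rewrite in_itv/= x0.
by have := near_in_itvoo xI; apply: filterS => y; rewrite in_itv.
Qed.

(** One derivative sends x^d h to x^(d-1) (x h' + d h), so each step is an application of
    [euler_comb] with d the current exponent. *)
Lemma derive1n_comb g n k L f : comb_level (n + k.+1) L ->
  (forall x, 0 < x -> x < 1 -> f x = w0_comb L x) ->
  forall i, (i <= n)%N -> exists L', [/\ comb_level (n - i + k.+1) L',
    forall x, 0 < x -> x < 1 ->
      derive1n i (fun y => y `^ (g + n%:R) * f y) x =
      x `^ (g + n%:R - i%:R) * w0_comb L' x &
    forall y, (forall j, 0 < y + a j) ->
      moment_comb L' y =
      \prod_(l < i) (g + n%:R - l%:R - y) * moment_comb L y].
Proof.
move=> Lk fL; elim=> [_|i ih ilen].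
  exists L; split; rewrite ?subn0//.
    by move=> x x0 x1; rewrite subr0 derive1n0 fL.
  by move=> y _; rewrite big_ord0 mul1r.
have [L1 [L1k dL1 mL1]] := ih (ltnW ilen).
have nik : (n - i + k.+1 = (n - i.+1 + k).+2)%N by rewrite -(subnSK ilen) addnS addSn.
set d := g + n%:R - i%:R.
rewrite nik in L1k; have [L2 [L2k dL2 mL2]] := euler_comb d L1k.
exists L2; split; first by rewrite addnS.
  move=> x x0 x1; rewrite derive1nS.
  have near_eq : \near x, (fun y => y `^ d) x * w0_comb L1 x =
      derive1n i (fun y => y `^ (g + n%:R) * f y) x.
    by apply: filterS (near_itv01 x0 x1) => y /andP[y0 y1]; rewrite dL1.
  have dpow : is_derive x 1 (fun y => y `^ d) (d * x `^ (d - 1)).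
    have x0' : x \in `]0, +oo[%R by rewrite in_itv/= x0.
    by rewrite -powR_derive1// derive1E; exact/derivableP/derivable_powR.
  have dM := is_deriveM dpow (dL2 x x0 x1).
  have [_ D] := near_eq_is_derive near_eq dM.
  rewrite derive1E D /GRing.scale/=.
  have -> : g + n%:R - i.+1%:R = d - 1 by rewrite -natr1 /d; ring.
  have -> : x `^ d = x `^ (d - 1) * x.
    rewrite -[X in _ = _ * X](powRr1 (ltW x0)) -powRD ?(gt_eqF x0) ?implybT//.
    by rewrite subrK.
  by field; rewrite gt_eqF.
by move=> y ya; rewrite mL2// mL1// big_ord_recr/= mulrA [_ * (d - y)]mulrC.
Qed.

Lemma rodrigues_comb g n k L f : comb_level (n + k.+1) L ->
  (forall x, 0 < x -> x < 1 -> f x = w0_comb L x) ->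
  exists L', [/\ comb_level k.+1 L',
    forall x, 0 < x -> x < 1 -> rodrigues g n f x = w0_comb L' x &
    forall y, (forall j, 0 < y + a j) ->
      moment_comb L' y = pochhammer (g + (1 - y)) n * moment_comb L y].
Proof.
move=> Lk fL; have [L' [L'k dL' mL']] := derive1n_comb g Lk fL (leqnn n).
exists L'; split; first by rewrite subnn in L'k.
  move=> x x0 x1; rewrite /rodrigues dL'// addrK mulrA -powRD ?(gt_eqF x0) ?implybT//.
  by rewrite addNr powRr0 mul1r.
move=> y ya; rewrite mL'//; congr (_ * _); rewrite /pochhammer.
(* Replacing l by n - 1 - l turns g + n - l - y into g + 1 - y + l. *)
rewrite (reindex_inj rev_ord_inj)/=; apply: eq_bigr => l _.
rewrite natrB; last exact: ltn_ord.
by rewrite -natr1; ring.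
Qed.

Lemma rodrigues_seq_comb p (g : 'I_p -> R) (n : 'I_p -> nat) k L f s :
  comb_level (\sum_(i <- s) n i + k.+1) L ->
  (forall x, 0 < x -> x < 1 -> f x = w0_comb L x) ->
  exists L', [/\ comb_level k.+1 L',
    forall x, 0 < x -> x < 1 ->
      foldr (fun i h => rodrigues (g i) (n i) h) f s x = w0_comb L' x &
    forall y, (forall j, 0 < y + a j) ->
      moment_comb L' y =
      \prod_(i <- s) pochhammer (g i + (1 - y)) (n i) * moment_comb L y].
Proof.
elim: s k => [|i s ih] k Lk fL.
  by exists L; split => // [|y _]; [rewrite big_nil in Lk|rewrite big_nil mul1r].
(* The operators of the tail act first and have to leave n_i further levels to the outermost one. *)
have [|L1 [L1k dL1 mL1]] := ih (n i + k)%N _ fL.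
  by move: Lk; rewrite big_cons -addnS addnCA addnA.
rewrite -addnS in L1k.
have [L2 [L2k dL2 mL2]] := rodrigues_comb (g i) L1k dL1.
exists L2; split => // y ya.
by rewrite mL2// mL1// big_cons mulrA.
Qed.

End w0_span.

(** * Uniqueness in the moment problem *)

Section moments.
Context {R : realType}.
Local Notation mu := (@lebesgue_measure R).
Implicit Types (g h : R -> R) (x t : R).

Definition has_moments g := forall k : nat,
  mu.-integrable `]0, +oo[ (EFin \o (fun t => t ^+ k * g t)).

Definition moment g k : R := \int[mu]_(t in `]0, +oo[) (t ^+ k * g t).

Let mD : measurable (`]0, +oo[%classic : set (measurableTypeR R)).
Proof. exact: measurable_itv. Qed.

Lemma has_momentsD g h : has_moments g -> has_moments h ->
  has_moments (fun t => g t + h t).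
Proof.
move=> mg mh k.
have := integrableD mD (mg k) (mh k); apply: eq_integrable => //.
by move=> t _ /=; rewrite -EFinD mulrDr.
Qed.

Lemma momentD g h k : has_moments g -> has_moments h ->
  moment (fun t => g t + h t) k = moment g k + moment h k.
Proof.
move=> mg mh; rewrite /moment -(RintegralD mD (mg k) (mh k)).
by apply: eq_Rintegral => t _; rewrite mulrDr.
Qed.

Lemma has_momentsZ c g : has_moments g -> has_moments (fun t => c * g t).
Proof.
move=> mg k.
have := integrableZl mD c (mg k); apply: eq_integrable => //.
by move=> t _ /=; rewrite -EFinM mulrCA.
Qed.

Lemma momentZ c g k : has_moments g -> moment (fun t => c * g t) k = c * moment g k.
Proof.
move=> mg; rewrite /moment -(RintegralZl _ mD (mg k)).
by apply: eq_Rintegral => t _; rewrite mulrCA.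
Qed.

Lemma has_momentsX g : has_moments g -> has_moments (fun t => t * g t).
Proof.
move=> mg k; have := mg k.+1; apply: eq_integrable => //.
by move=> t _ /=; rewrite exprSr mulrA.
Qed.

Lemma momentX g k : moment (fun t => t * g t) k = moment g k.+1.
Proof. by apply: eq_Rintegral => t _; rewrite exprSr mulrA. Qed.

Lemma has_moments0 : has_moments (fun=> 0).
Proof.
move=> k; have := integrable0 mu (`]0, +oo[%classic : set (measurableTypeR R)).
apply: eq_integrable => //.
by move=> t _ /=; rewrite mulr0.
Qed.

Lemma moment0 k : moment (fun=> 0) k = 0.
Proof.
rewrite /moment (@eq_Rintegral _ _ _ _ _ (cst 0)); last by move=> t _; rewrite mulr0.
by rewrite /Rintegral integral0.
Qed.

Lemma has_moments_sum (I : Type) (s : seq I) (g : I -> R -> R) :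
  (forall i, has_moments (g i)) -> has_moments (fun t => \sum_(i <- s) g i t).
Proof.
move=> mg; elim: s => [|i s ih].
  rewrite (_ : (fun _ => _) = (fun=> 0)); first exact: has_moments0.
  by apply/funext => t; rewrite big_nil.
rewrite (_ : (fun _ => _) = (fun t => g i t + \sum_(i <- s) g i t)).
  exact: has_momentsD.
by apply/funext => t; rewrite big_cons.
Qed.

Lemma moment_sum (I : Type) (s : seq I) (g : I -> R -> R) k :
  (forall i, has_moments (g i)) ->
  moment (fun t => \sum_(i <- s) g i t) k = \sum_(i <- s) moment (g i) k.
Proof.
move=> mg; elim: s => [|i s ih].
  rewrite big_nil -[RHS](moment0 k); congr (moment _ k).
  by apply/funext => t; rewrite big_nil.
rewrite big_cons -ih -momentD//; last exact: has_moments_sum.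
by congr (moment _ k); apply/funext => t; rewrite big_cons.
Qed.

Lemma has_moments_horner (P : {poly R}) g : has_moments g ->
  has_moments (fun t => P.[t] * g t).
Proof.
move=> mg; elim/poly_ind: P => [|P c ih].
  rewrite (_ : (fun _ => _) = (fun=> 0)); first exact: has_moments0.
  by apply/funext => t; rewrite horner0 mul0r.
rewrite (_ : (fun _ => _) = (fun t => t * (P.[t] * g t) + c * g t)).
  by apply: has_momentsD; [exact: has_momentsX|exact: has_momentsZ].
by apply/funext => t; rewrite hornerMXaddC; ring.
Qed.

Lemma moment_horner0 (P : {poly R}) g k : has_moments g ->
  (forall k, moment g k = 0) -> moment (fun t => P.[t] * g t) k = 0.
Proof.
move=> mg g0; elim/poly_ind: P k => [|P c ih] k.
  rewrite -[RHS](moment0 k); congr (moment _ k).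
  by apply/funext => t; rewrite horner0 mul0r.
have mP := has_moments_horner P mg.
transitivity (moment (fun t => t * (P.[t] * g t) + c * g t) k).
  by congr (moment _ k); apply/funext => t; rewrite hornerMXaddC; ring.
rewrite momentD ?momentX ?momentZ ?ih ?g0 ?mulr0 ?addr0//.
  exact: has_momentsX.
exact: has_momentsZ.
Qed.

(* The polynomials [(1 + d^2/2 - (t - x)^2)^N] concentrate near [x]: they blow
   up on [|t - x| < d/2] and stay within [0, 1] on (0, 1) when [|t - x| >= d]. *)
Lemma zero_moments_le0 g x : has_moments g -> (forall k, moment g k = 0) ->
  (forall t, 1 <= t -> g t = 0) -> 0 < x -> x < 1 ->
  {for x, continuous g} -> g x <= 0.
Proof.
move=> mg g0 g1 x0 x1 cg; rewrite leNgt; apply/negP => gx.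
have [d [d0 dx d1x gd]] : exists d : R, [/\ 0 < d, d <= x, d <= 1 - x &
    forall t, `|t - x| < d -> g x / 2 <= g t].
  have : \forall t \near x, g x / 2 <= g t.
    have /cvgr_ge := cg; apply.
    by rewrite ltr_pdivrMr// ltr_pMr// ltr1n.
  move=> [e /= e0 He]; exists (Num.min e (Num.min x (1 - x))); split.
  - by rewrite !lt_min e0 x0 subr_gt0.
  - by rewrite !ge_min lexx orbT.
  - by rewrite !ge_min lexx !orbT.
  - move=> t; rewrite !lt_min => /andP[te _]; apply: He.
    by rewrite /ball_/= distrC.
pose J : set R := `](x - d / 2), (x + d / 2)[%classic.
have JD : J `<=` `]0, +oo[.
  by move=> t; rewrite /J /= !in_itv/= andbT => /andP[+ _]; apply: lt_trans; lra.
pose P : {poly R} := (1 + d ^+ 2 / 2)%:P - ('X - x%:P) ^+ 2.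
have PE t : P.[t] = 1 + d ^+ 2 / 2 - (t - x) ^+ 2 by rewrite !hornerE.
(* On J the base is at least 1 + d^2/4, so by Bernoulli's inequality its N-th power is at least N
   d^2/4, while g >= g(x)/2. *)
pose K := g x / 2 * (d ^+ 2 / 4).
have K0 : 0 < K by rewrite mulr_gt0 ?divr_gt0 ?exprn_gt0.
have dd0 : 0 < d ^+ 2 by rewrite exprn_gt0.
(* On J the bound N K applies. Elsewhere with |t - x| < d, both factors are nonnegative. Farther
   away inside (0, 1) the power lies in [0, 1], so the product is at least -|g|. For t >= 1, g
   vanishes. *)
have lower N t : 0 < t -> N%:R * K * \1_J t - `|g t| <= (P ^+ N).[t] * g t.
  move=> t0; rewrite horner_exp PE.
  have [t1|t1] := leP 1 t.
    rewrite g1// normr0 mulr0 subr0 indicE memNset ?mulr0//.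
    by rewrite /J/= in_itv/=; apply/negP; rewrite negb_and -!leNgt; apply/orP; right; lra.
  have sq1 : (t - x) ^+ 2 <= 1 by nra.
  have p0 : 0 <= 1 + d ^+ 2 / 2 - (t - x) ^+ 2 by lra.
  have [td|td] := ltP `|t - x| d.
    have gt := gd t td.
    have gt0 : 0 < g t by lra.
    rewrite indicE; have [tJ|_] := boolP (t \in J); last first.
      rewrite mulr0 sub0r (le_trans (_ : _ <= 0)) ?oppr_le0//.
      by rewrite mulr_ge0 ?exprn_ge0// ltW.
    rewrite mulr1 (le_trans (_ : _ <= N%:R * K))//; first by rewrite gerBl.
    have pN : N%:R * (d ^+ 2 / 4) <= (1 + d ^+ 2 / 2 - (t - x) ^+ 2) ^+ N.
      have p1 : 1 + d ^+ 2 / 4 <= 1 + d ^+ 2 / 2 - (t - x) ^+ 2.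
        move: tJ; rewrite inE /J/= in_itv/= => /andP[tJ1 tJ2]; nra.
      apply: (@le_trans _ _ ((1 + d ^+ 2 / 4) ^+ N)); last first.
        by apply: lerXn2r; rewrite ?nnegrE//; lra.
      elim: N => [|N ih]; first by rewrite mul0r expr0.
      rewrite [leRHS]exprS -natr1.
      have e1 : 1 <= (1 + d ^+ 2 / 4) ^+ N by apply: exprn_ege1; lra.
      rewrite !mulrDl !mul1r; apply: lerD => //.
      by rewrite ler_peMr// divr_ge0// ltW.
    apply: (@le_trans _ _ (N%:R * (d ^+ 2 / 4) * (g x / 2))).
      by rewrite /K mulrA mulrAC.
    by apply: ler_pM => //; [apply: mulr_ge0 => //|]; lra.
  have p1 : 1 + d ^+ 2 / 2 - (t - x) ^+ 2 <= 1.
    have : d ^+ 2 <= (t - x) ^+ 2.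
      have [tx|tx] := ltP (t - x) 0; move: td.
        rewrite ltr0_norm// => td.
        have : 0 <= (- (t - x) - d) * (- (t - x) + d) by apply: mulr_ge0; lra.
        by clear -d; nra.
      rewrite ger0_norm// => td.
      have : 0 <= (t - x - d) * (t - x + d) by apply: mulr_ge0; lra.
      by clear -d; nra.
    lra.
  rewrite indicE memNset ?mulr0 ?sub0r; last first.
    rewrite /J/= in_itv/= => /andP[tJ1 tJ2].
    by move: td; rewrite leNgt ltr_norml; apply/negP; rewrite negbK; apply/andP; split; lra.
  rewrite lerNl (le_trans (ler_norm _))// normrN normrM ler_piMl//.
  by rewrite ger0_norm ?exprn_ge0// exprn_ile1.
have mgint : mu.-integrable `]0, +oo[ (EFin \o g).
  have := mg 0%N; apply: eq_integrable => //.
  by move=> t _ /=; rewrite expr0 mul1r.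
have mgn : mu.-integrable `]0, +oo[ (EFin \o (fun t => `|g t|)).
  have := integrable_abse mgint; apply: eq_integrable => //.
have mJ : measurable (J : set (measurableTypeR R)) by exact: measurable_itv.
have J_d : (\int[mu]_(t in `]0%R, +oo[) (\1_J t)%:E = d%:E)%E.
  rewrite integral_indic// (setIidl JD) /J.
  apply: etrans (lebesgue_measure_itv _) _; rewrite /= lte_fin ifT; last by lra.
  by rewrite -EFinB; congr EFin; lra.
have iJ : mu.-integrable `]0, +oo[ (EFin \o (\1_J : R -> R)).
  apply/integrableP; split.
    by apply/measurable_EFinP; apply: measurable_funTS; exact: measurable_indic.
  rewrite (_ : integral _ _ _ = d%:E) ?ltry// -J_d.
  by apply: eq_integral => t _ /=; rewrite ger0_norm// indicE.
(* The polynomial multiple of g has integral 0 and J has length d; the integrated lower bound fails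
   for large N. *)
have ineq N : N%:R * K * d <= \int[mu]_(t in `]0, +oo[) `|g t|.
  rewrite -subr_le0 -[leRHS](moment_horner0 (P ^+ N) 0 mg g0).
  have iJN : mu.-integrable `]0, +oo[ (EFin \o (fun t => N%:R * K * \1_J t)).
    by have := integrableZl mD (N%:R * K) iJ; apply: eq_integrable.
  have -> : d = \int[mu]_(t in `]0, +oo[) (\1_J t) by rewrite /Rintegral J_d.
  rewrite -(RintegralZl _ mD iJ) -RintegralB//.
  apply: le_Rintegral => //.
  - by have := integrableB mD iJN mgn; apply: eq_integrable.
  - by have := has_moments_horner (P ^+ N) mg 0%N.
  - move=> t; rewrite /= in_itv/= andbT => t0.
    by rewrite expr0 mul1r; exact: lower.
have Kd0 : 0 < K * d by rewrite mulr_gt0.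
have := ineq (Num.truncn (\int[mu]_(t in `]0, +oo[) `|g t| / (K * d))).+1.
apply/negP; rewrite -ltNge -mulrA -ltr_pdivrMr//.
exact: truncnS_gt.
Qed.

Lemma zero_moments_eq0 g x : has_moments g -> (forall k, moment g k = 0) ->
  (forall t, 1 <= t -> g t = 0) -> 0 < x -> x < 1 ->
  {for x, continuous g} -> g x = 0.
Proof.
move=> mg g0 g1 x0 x1 cg; apply/eqP; rewrite eq_le zero_moments_le0//=.
have mgN : has_moments (fun t => -1 * g t) by exact: has_momentsZ.
rewrite -oppr_le0 -mulN1r; apply: (zero_moments_le0 mgN) => //.
- by move=> k; rewrite momentZ// g0 mulr0.
- by move=> t t1; rewrite g1// mulr0.
- by apply: cvgM => //; exact: cvg_cst.
Qed.

End moments.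

(** * Mixed forms *)

Section complex_aux.
Context {R : realType}.
Implicit Types (x t : R) (z : R[i]).

Lemma Re_mul_real z x : complex.Re (z * x%:C) = complex.Re z * x.
Proof. by case: z => u v /=; rewrite mulr0 subr0. Qed.

Lemma Im_mul_real z x : complex.Im (z * x%:C) = complex.Im z * x.
Proof. by case: z => u v /=; rewrite mulr0 add0r. Qed.

Lemma cpow_real t x : 0 < t -> cpow t x%:C = (t `^ x)%:C.
Proof.
by move=> t0; rewrite /cpow /= mul0r cos0 sin0 complexr0 mulr1 powR_expR.
Qed.

Lemma cGamma_real x : cGamma x%:C = (Gamma x)%:C.
Proof.
rewrite /cGamma /mellin /cintegral.
have cpowE t : t \in (`]0, +oo[%classic : set R) ->
    cpow t (x%:C - 1) * (expR (- t))%:C = (t `^ (x - 1) * expR (- t))%:C.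
  rewrite inE/= in_itv/= andbT => t0.
  by rewrite -(rmorph1 (real_complex R)) -rmorphB cpow_real// -rmorphM.
congr (_ +i* _).
  by apply: eq_Rintegral => t t0; rewrite cpowE.
rewrite (@eq_Rintegral _ _ _ _ _ (cst 0)); first by rewrite /Rintegral integral0.
by move=> t t0; rewrite cpowE.
Qed.

(* Covers both the real and the imaginary part. *)
Definition real_linear (f : R[i] -> R) :=
  (forall z z', f (z + z') = f z + f z') /\ (forall z x, f (z * x%:C) = f z * x).

Lemma real_linear_horner f (P : {poly R[i]}) x : real_linear f ->
  f P.[x%:C] = (\poly_(i < size P) f P`_i).[x].
Proof.
move=> [fD fM]; have f0 : f 0 = 0.
  by have := fM 0 0; rewrite mul0r mulr0.
rewrite horner_coef horner_poly (big_morph f fD f0); apply: eq_bigr => i _.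
by rewrite -rmorphXn fM.
Qed.

End complex_aux.

Lemma continuous_sum (R : realType) (I : Type) (s : seq I) (f : I -> R -> R) (x : R) :
  (forall i, {for x, continuous (f i)}) ->
  {for x, continuous (fun t => \sum_(i <- s) f i t)}.
Proof.
move=> cf; elim: s => [|i s ih].
  rewrite (_ : (fun _ => _) = cst 0); first exact: cst_continuous.
  by apply/funext => t; rewrite big_nil.
rewrite (_ : (fun _ => _) = (fun t => f i t + \sum_(i <- s) f i t)).
  by apply: cvgD; [exact: cf|exact: ih].
by apply/funext => t; rewrite big_cons.
Qed.

(** * Comparison of moments and the Rodrigues formula *)

Section main.
Context {R : realType} (q : nat) (a b : 'I_q -> R).
Hypotheses (q0 : (0 < q)%N) (a1 : forall j, -1 < a j) (ab : forall j, a j < b j).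
Local Notation mu := (@lebesgue_measure R).

Lemma has_moments_w0 c : ew0_admissible a c -> has_moments (w0 a c).
Proof. by move=> ac k; exact: integrable_w0. Qed.

Lemma moment_w0 c k : ew0_admissible a c ->
  moment (w0 a c) k = gamma_ratio a c k.+1%:R.
Proof. by move=> ac; rewrite /moment /Rintegral integral_w0. Qed.

Let ac nu : ew0_admissible a (shift_param b nu) := shift_param_admissible ab nu.

Lemma has_moments_comb L : has_moments (w0_comb a b L).
Proof.
by apply: has_moments_sum => p; apply: has_momentsZ; exact: has_moments_w0.
Qed.

Lemma moment_w0_comb L k : moment (w0_comb a b L) k = moment_comb a b L k.+1%:R.
Proof.
rewrite moment_sum => [|p]; last by apply: has_momentsZ; exact: has_moments_w0.
by apply: eq_bigr => p _; rewrite momentZ ?moment_w0//; exact: has_moments_w0.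
Qed.

Lemma w0_comb_ge1 L x : 1 <= x -> w0_comb a b L x = 0.
Proof. by move=> x1; apply: big1 => p _; rewrite w0_ge1 ?mulr0. Qed.

(** f is the real or the imaginary part, with [kappa] equal to 1 or 0, since the prescribed moments
    are real. Uniqueness is applied to the difference of the two sides, continuous because each
    [w a b j] is already one convolution above [w0 a b]. *)
Lemma linear_form_eq_comb (f : R[i] -> R) (B : 'I_q -> {poly R[i]}) L (kappa x : R) :
  real_linear f -> comb_level 1 L ->
  (forall k, \int[mu]_(t in `]0, +oo[) (t ^+ k * f (linear_form a b B t)) =
    - kappa * moment_comb a b L k.+1%:R) ->
  0 < x -> x < 1 -> f (linear_form a b B x) = - kappa * w0_comb a b L x.
Proof.
move=> fR L1 fB x0 x1; have [fD fM] := fR.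
have f0 : f 0 = 0 by have := fM 0 0; rewrite mul0r mulr0.
pose Q j : {poly R} := \poly_(i < size (B j)) f (B j)`_i.
have fE t : f (linear_form a b B t) = \sum_(j < q) (Q j).[t] * w a b j t.
  rewrite /linear_form (big_morph f fD f0); apply: eq_bigr => j _.
  by rewrite fM real_linear_horner.
have ai j : ew0_admissible a (incr b j) by exact: ew0_admissible_incr.
have mw j : has_moments (fun t => (Q j).[t] * w a b j t).
  by apply: has_moments_horner; exact: has_moments_w0 (ai j).
have mf : has_moments (fun t => f (linear_form a b B t)).
  rewrite (_ : (fun _ => _) = (fun t => \sum_(j < q) (Q j).[t] * w a b j t)).
    exact: has_moments_sum.
  exact/funext.
have mL := has_momentsZ kappa (has_moments_comb L).
have := @zero_moments_eq0 _ _ x (has_momentsD mf mL).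
move=> H; apply/eqP; rewrite -subr_eq0 mulNr opprK; apply/eqP; apply: H => //.
- move=> k; rewrite momentD// momentZ ?moment_w0_comb; last exact: has_moments_comb.
  by rewrite /moment fB mulNr addNr.
- move=> t t1; rewrite w0_comb_ge1// mulr0 addr0 fE; apply: big1 => j _.
  by rewrite /w -/(incr b j) (w0_ge1 a1 (ai j))// mulr0.
- apply: cvgD; last first.
    by apply: cvgM; [exact: cvg_cst|exact: continuous_w0_comb].
  rewrite (_ : (fun _ => _) = (fun t => \sum_(j < q) (Q j).[t] * w a b j t)); last first.
    exact/funext.
  rewrite fE; apply: continuous_sum => j.
  apply: cvgM; first exact: continuous_horner.
  exact: (continuous_w0_incr q0 a1 ab x0 x1).
Qed.

End main.

Theorem theorem5p3 (R : realType) (p q : nat) (hp : (1 <= p)%N) (hq : (1 <= q)%N)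
  (a b : 'I_q -> R) (alpha : 'I_p -> R)
  (ha : forall j, -1 < a j) (hab : forall j, a j < b j)
  (halpha : forall i rho, -1 < alpha i + a rho)
  (n : 'I_p -> nat) (m : 'I_q -> nat)
  (hmn : (\sum_(j < q) m j = \sum_(i < p) n i + 1)%N)
  (hm : forall i j, (m i <= m j + 1)%N)
  (hnodes : forall (j j' : 'I_q) (l l' : nat), (l < m j)%N -> (l' < m j')%N ->
    - b j - l%:R = - b j' - l'%:R -> j = j' /\ l = l')
  (hb : forall h j : 'I_q, h <> j -> (1 <= m j)%N -> b h <> b j)
  (hres : forall (rho J : 'I_q) (k : nat), (k < m J)%N -> a rho - b J <> k%:R)
  (B : 'I_q -> {poly R[i]})
  (hB : normalized_mixed_form a b alpha n m B)
  (x : R) (hx0 : 0 < x) (hx1 : x < 1) :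
  linear_form a b B x =
  - (rodrigues_vec alpha n (w0 a (fun j => b j + (m j)%:R)) x)%:C.
Proof.
(* The initial weight has level |m| = |n| + 1; after |n| derivatives level 1 remains, which provides
   continuity. *)
have L0 : comb_level (\sum_(i <- enum 'I_p) n i + 1) [:: (1 : R, m)].
  by rewrite /comb_level/= hmn andbT big_enum.
have f0 y : 0 < y -> y < 1 ->
    w0 a (fun j => b j + (m j)%:R) y = w0_comb a b [:: (1 : R, m)] y.
  by move=> _ _; rewrite /w0_comb big_seq1 mul1r.
have [L [L1 rodE mL]] := rodrigues_seq_comb hq ha hab alpha L0 f0.
rewrite /rodrigues_vec rodE// {rodE}.
have ya k j : 0 < k.+1%:R + a j.
  by have := ha j; have : 0 <= k%:R :> R by []; rewrite -natr1; lra.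
have mellinE k : mellin (linear_form a b B) k.+1%:R = - (moment_comb a b L k.+1%:R)%:C.
  have sE : k.+1%:R = (k.+1%:R : R)%:C :> R[i] by rewrite rmorph_nat.
  rewrite (mixed_form_mellin hB) sE; last by move=> j; exact: ya.
  rewrite mL; last exact: ya.
  rewrite /moment_comb big_seq1 mul1r big_enum/= rmorphM mulrC; congr (- (_ * _)).
    rewrite rmorph_prod; apply: eq_bigr => i _; rewrite /pochhammer rmorph_prod.
    by apply: eq_bigr => l _; rewrite !rmorphD rmorphN rmorph1 !rmorph_nat.
  rewrite /gamma_ratio rmorph_prod -prodf_div; apply: eq_bigr => j _.
  by rewrite -!rmorphD !cGamma_real rmorphM fmorphV.
(* At s = k + 1 the Mellin kernel t^(s-1) is the real monomial t^k, so real and imaginary parts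
   separate. *)
have cpowE k t z : 0 < t -> cpow t (k.+1%:R - 1) * z = z * (t ^+ k)%:C.
  move=> t0; have := cpow_real k%:R t0; rewrite rmorph_nat -natr1 addrK => ->.
  by rewrite powR_mulrn ?ltW// mulrC.
have ReL : real_linear (@complex.Re R).
  by split; [exact: raddfD|exact: Re_mul_real].
have ImL : real_linear (@complex.Im R).
  by split; [exact: raddfD|exact: Im_mul_real].
apply/eqP; rewrite eq_complex; apply/andP; split; apply/eqP.
  rewrite (linear_form_eq_comb (kappa := 1) hq ha hab ReL L1 _ hx0 hx1) ?mulN1r//.
  move=> k; transitivity (complex.Re (mellin (linear_form a b B) k.+1%:R));
    last by rewrite mellinE /= mulN1r.
  apply: eq_Rintegral => t; rewrite inE/= in_itv/= andbT => t0.
  by rewrite cpowE// Re_mul_real mulrC.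
rewrite (linear_form_eq_comb (kappa := 0) hq ha hab ImL L1 _ hx0 hx1).
  by rewrite /= oppr0 mul0r.
move=> k; transitivity (complex.Im (mellin (linear_form a b B) k.+1%:R));
  last by rewrite mellinE /= oppr0 mul0r.
apply: eq_Rintegral => t; rewrite inE/= in_itv/= andbT => t0.
by rewrite cpowE// Im_mul_real mulrC.
Qed.
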